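(* Let $\underline{\mathbb{G}}=(\mathbb{G},\mathcal{V},\omega_{\mathcal{V}},\mathcal{F},\omega_{\mathcal{F}})$ be a packaged ribbon graph and $e$ an edge of $\mathbb{G}$. Then \[\boldsymbol{T}(\underline{\mathbb{G}};\boldsymbol{x},\boldsymbol{y}) = x^{2-\eta(e)}\boldsymbol{T}(\underline{\mathbb{G}}\backslash e;\boldsymbol{x},\boldsymbol{y})+y^{2-\mu(e)}\boldsymbol{T}(\underline{\mathbb{G}}/e;\boldsymbol{x},\boldsymbol{y}).\] If $\mathbb{G}$ has no edges, then \[\boldsymbol{T}(\underline{\mathbb{G}};\boldsymbol{x},\boldsymbol{y})=\prod_{[f]\in \mathcal{F}} x_{(1- |[f]| +\omega_{\mathcal{F}}([f]))/2} \prod_{[v]\in\mathcal{V}} y_{(1-|[v]| +\omega_{\mathcal{V}}([v]))/2},\] where $|[a]|$ is the number of elements of the block $[a]$.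
   Context: All ribbon graphs are orientable. A ribbon graph $\mathbb{G}=(V,E)$ is an orientable surface with boundary formed as a union of discs $V$ (vertices) and discs $E$ (edges) such that vertices and edges meet in disjoint arcs, each arc lies on the boundary of exactly one vertex and one edge, and each edge contains exactly two such arcs. For a ribbon graph, $v,e,f,k$ denote numbers of vertices, edges, boundary components, components. For a graph, $v,e,k$ are numbers of vertices, edges, components, and nullity $n=e-v+k$. $\mathbb{G}\backslash e$ removes edge $e$; $\mathbb{G}|A$ (for $A\subseteq E$) is the spanning ribbon subgraph with edge set $A$; $A^c=E\setminus A$. $\mathbb{G}/e$ (contraction) is obtained by taking the boundary curve(s) of $e\cup u\cup v$ ($u,v$ the ends of $e$), attaching a disc to each curve as a new vertex, and removing $e,u,v$. The dual $\mathbb{G}^*$ is obtained by capping each boundary component of $\mathbb{G}$ with a disc; these discs are the vertices of $\mathbb{G}^*$ and the edges are those of $\mathbb{G}$; so vertices of $\mathbb{G}^*$ are identified with boundary components of $\mathbb{G}$ and vice versa. A packaged ribbon graph is a tuple $\underline{\mathbb{G}}=(\mathbb{G},\mathcal{V},\omega_{\mathcal{V}},\mathcal{F},\omega_{\mathcal{F}})$ where $\mathbb{G}=(V,E)$ is a ribbon graph with set of boundary components $F$, $\mathcal{V}$ a partition of $V$, $\mathcal{F}$ a partition of $F$, and $\omega_{\mathcal{V}}:\mathcal{V}\to\mathbb{N}_0$, $\omega_{\mathcal{F}}:\mathcal{F}\to\mathbb{N}_0$ weightings; $[v]$, $[f]$ denote blocks. For an edge $e$, $\eta(e)$ is the number of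 blocks of $\mathcal{F}$ containing a boundary component meeting $e$, and $\mu(e)$ is the number of blocks of $\mathcal{V}$ containing a vertex incident with $e$ (each is 1 or 2). Deletion $\underline{\mathbb{G}}\backslash e$: ribbon graph $\mathbb{G}\backslash e$, $\mathcal{V},\omega_{\mathcal{V}}$ unchanged, boundary components not meeting $e$ keep blocks/weights. (i) If $e$ meets a single boundary component $f$, deletion creates $f',g'$ replacing $f$; $[f]$ becomes $([f]\setminus\{f\})\cup\{f',g'\}$ with weight $\omega_{\mathcal{F}}([f])+1$. (ii) If $e$ meets $f\neq g$ with $[f]=[g]$, deletion creates one component $f'$; block becomes $([f]\setminus\{f,g\})\cup\{f'\}$ with weight $\omega_{\mathcal{F}}([f])+1$. (iii) If $e$ meets $f\neq g$ with $[f]\ne[g]$, the blocks $[f],[g]$ are replaced by $([f]\cup[g]\setminus\{f,g\})\cup\{f'\}$ with weight $\omega_{\mathcal{F}}([f])+\omega_{\mathcal{F}}([g])$. Contraction $\underline{\mathbb{G}}/e$: ribbon graph $\mathbb{G}/e$, $\mathcal{F},\omega_{\mathcal{F}}$ transported via the natural correspondence of boundary components. (i) If $e$ is a loop at $u$, contraction creates two vertices $u',v'$ replacing $u$; $[u]$ becomes $([u]\setminus\{u\})\cup\{u',v'\}$ with weight $\omega_{\mathcal{V}}([u])+1$. (ii) If $e$ has ends $u\neq v$ with $[u]=[v]$, merged vertex $u'$; block becomes $([u]\setminus\{u,v\})\cup\{u'\}$ with weight $\omega_{\mathcal{V}}([u])+1$. (iii) If $[u]\neq[v]$, blocks $[u],[v]$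 replaced by $([u]\cup[v]\setminus\{u,v\})\cup\{u'\}$ with weight $\omega_{\mathcal{V}}([u])+\omega_{\mathcal{V}}([v])$. Other blocks/weights unchanged in all cases. Packaging: for a ribbon graph $\mathbb{H}$ with a partition $\mathcal{P}$ of its vertex set and block weights $\omega$, $G(\mathbb{H};\mathcal{P})$ is the graph with vertex set $\mathcal{P}$ and one edge $([u],[v])$ for each edge $(u,v)$ of $\mathbb{H}$ (loops and multiple edges allowed), vertices weighted by $\omega$. For a subgraph $K$ of $G(\mathbb{H};\mathcal{P})$, $\mathbb{H}[K]$ is the ribbon subgraph of $\mathbb{H}$ whose vertices are all vertices of $\mathbb{H}$ lying in blocks that are vertices of $K$ and whose edges are those corresponding to edges of $K$; $f(\mathbb{H}[K])$ is its number of boundary components; $\omega(K)=\sum_{[v]\in V(K)}\omega([v])$. Here $G(\mathbb{G}|A;\mathcal{V})$ uses $\mathcal{V},\omega_{\mathcal{V}}$, and $G(\mathbb{G}^*|A^c;\mathcal{F})$ uses $\mathcal{F},\omega_{\mathcal{F}}$ as a partition (with weights) of the vertex set of $\mathbb{G}^*$. The packaged surface Tutte polynomial, with variables $\boldsymbol{x}=(x,x_0,x_{1/2},x_1,\dots)$, $\boldsymbol{y}=(y,y_0,y_{1/2},y_1,\dots)$, is \[\boldsymbol{T}(\underline{\mathbb{G}};\boldsymbol{x},\boldsymbol{y})= \sum_{A\subseteq E} x^{n(G(\mathbb{G}^*|A^c;\mathcal{F}))}y^{n(G(\mathbb{G}|A;\mathcal{V}))}\prod_{H \text{ cpt. of }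 G(\mathbb{G}^*|A^c;\mathcal{F})}x_{g(\mathbb{G}^*,H)}\prod_{K \text{ cpt. of } G(\mathbb{G}|A;\mathcal{V})}y_{g(\mathbb{G},K)},\] where $g(\mathbb{G},K)=\tfrac12(2k(K)+e(K)-v(K)+\omega_{\mathcal{V}}(K)-f(\mathbb{G}[K]))$ and $g(\mathbb{G}^*,H)=\tfrac12(2k(H)+e(H)-v(H)+\omega_{\mathcal{F}}(H)-f(\mathbb{G}^*[H]))$. *)

(* Defs.v *)
From HB Require Import structures.
From mathcomp Require Import all_boot all_order all_algebra all_fingroup.
Set Implicit Arguments.
Unset Strict Implicit.
Unset Printing Implicit Defensive.
Import GRing.Theory.

(* Orientable ribbon graphs, encoded combinatorially (rotation systems). *)
(* Darts (half-edges) are pairs (edge, side) : E * bool; the edge        *)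
(* involution alpha flips the side.  rsigma is the rotation at vertices  *)
(* (its cycles are the cyclic orders of darts around each vertex), and   *)
(* the boundary components are the cycles of phi = sigma o alpha.        *)
(* Vertices and boundary components are carried by explicit finite types *)
(* so that isolated vertices (and their boundary components) exist.      *)

Definition flipd {E : Type} (d : E * bool) : E * bool := (d.1, ~~ d.2).

Lemma flipd_inj (E : Type) : injective (@flipd E).
Proof. by case=> a b [c d] [-> /negb_inj ->]. Qed.

Record rgraph := RGraph {
  redge : finType;
  rvert : finType;
  rface : finType;
  rsigma : {perm (redge * bool)};
  rvx : redge * bool -> rvert;
  rfx : redge * bool -> rface
}.

Arguments rsigma : clear implicits.
Arguments rvx : clear implicits.
Arguments rfx : clear implicits.

Definition ralpha (G : rgraph) : {perm (redge G * bool)} := perm (@flipd_inj (redge G)).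
Definition rphi (G : rgraph) : {perm (redge G * bool)} := (ralpha G * rsigma G)%g.

(* Well-formedness: vertices with darts are exactly the sigma-cycles,
   boundary components with darts are exactly the phi-cycles, and the
   remaining (isolated) vertices are as many as the remaining boundary
   components (each isolated vertex disc has exactly one boundary). *)
Definition rg_ok (G : rgraph) : Prop :=
  [/\ forall d d', (rvx G d == rvx G d') = fconnect (rsigma G) d d',
      forall d d', (rfx G d == rfx G d') = fconnect (rphi G) d d' &
      #|[set v | v \notin codom (rvx G)]| = #|[set f | f \notin codom (rfx G)]| ].

Definition rdual (G : rgraph) : rgraph :=
  @RGraph (redge G) (rface G) (rvert G) (rphi G) (rfx G) (rvx G).

(* Packaged ribbon graphs.  A partition of a finite set X is given by a  *)
(* block-labelling p : X -> nat (blocks = nonempty fibres of p) and the  *)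
(* weight of the block labelled l is w l.                                *)

Record pkg := Pkg {
  pg : rgraph;
  pv : rvert pg -> nat;  wv : nat -> nat;
  pf : rface pg -> nat;  wf : nat -> nat
}.

Arguments pv : clear implicits.
Arguments wv : clear implicits.
Arguments pf : clear implicits.
Arguments wf : clear implicits.

Definition pkg_ok (P : pkg) : Prop := rg_ok (pg P).

Definition pdual (P : pkg) : pkg :=
  @Pkg (rdual (pg P)) (pf P) (wf P) (pv P) (wv P).

(* first element of S strictly after d along the rho-orbit of d
   (the induced rotation on the sub-darts S) *)
Definition next_in (T : finType) (rho : T -> T) (S : {set T}) (d : T) : T :=
  head d [seq z <- [seq iter k.+1 rho d | k <- iota 0 #|T|] | z \in S].

(* Number of boundary components of the ribbon subgraph with vertex set C
   (vertices labelled via lab) and edge set S, in the ribbon graph whose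
   vertex rotation is rho: cycles of (rho restricted to S-darts) o alpha,
   plus one for each vertex of C carrying no dart of S. *)
Definition nbound (E X : finType) (rho : E * bool -> E * bool)
    (lab : E * bool -> X) (C : {set X}) (S : {set E}) : nat :=
  let DS := [set d : E * bool | d.1 \in S] in
  let g := fun d => next_in rho DS (flipd d) in
  #|[set [set z | fconnect g d z] | d in DS]|
  + #|[set x in C | [forall d in DS, lab d != x]]|.

Definition crel (E X : finType) (lab : E * bool -> X) (p : X -> nat)
    (A : {set E}) : rel X :=
  fun u w => (p u == p w) ||
    [exists x in A, ((lab (x, false) == u) && (lab (x, true) == w))
                 || ((lab (x, false) == w) && (lab (x, true) == u))].

(* connected components of G(H|A; P), each given by the set of vertices
   of H lying in its blocks (= the vertex set of H[K]) *)
Definition comps (E X : finType) (lab : E * bool -> X) (p : X -> nat)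
    (A : {set E}) : {set {set X}} :=
  [set [set w | connect (crel lab p A) u w] | u : X].

Definition nlabels (X : finType) (p : X -> nat) (C : {set X}) : seq nat :=
  undup [seq p u | u <- enum C].

Definition nullity (E X : finType) (lab : E * bool -> X) (p : X -> nat)
    (A : {set E}) : nat :=
  (#|A| + #|comps lab p A| - size (nlabels p setT))%N.

(* 2 g(H, K) = 2k(K) + e(K) - v(K) + omega(K) - f(H[K]) for the component
   K of G(H|A;P) with vertex set C (as an integer) *)
Definition gidx (E X : finType) (rho : E * bool -> E * bool)
    (lab : E * bool -> X) (p : X -> nat) (w : nat -> nat)
    (A : {set E}) (C : {set X}) : int :=
  let S := [set x in A | lab (x, false) \in C] in
  ((2 + #|S| + \sum_(l <- nlabels p C) w l)%N)%:Z
  - ((size (nlabels p C) + nbound rho lab C S)%N)%:Z.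

(* The packaged surface Tutte polynomial, evaluated in an arbitrary
   commutative ring: x, y are the variables x, y and xs n (resp. ys n),
   n : int, stands for the variable x_{n/2} (resp. y_{n/2}). *)
Definition Tpoly (R : comPzRingType) (P : pkg) (x y : R) (xs ys : int -> R) : R :=
  let G := pg P in
  \sum_(A : {set redge G})
     (x ^+ nullity (rfx G) (pf P) (~: A) * y ^+ nullity (rvx G) (pv P) A
      * \prod_(C in comps (rfx G) (pf P) (~: A))
           xs (gidx (rphi G) (rfx G) (pf P) (wf P) (~: A) C)
      * \prod_(C in comps (rvx G) (pv P) A)
           ys (gidx (rsigma G) (rvx G) (pv P) (wv P) A C)).

Definition eta (P : pkg) (e : redge (pg P)) : nat :=
  if pf P (rfx (pg P) (e, false)) == pf P (rfx (pg P) (e, true)) then 1 else 2.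
Definition mu (P : pkg) (e : redge (pg P)) : nat :=
  if pv P (rvx (pg P) (e, false)) == pv P (rvx (pg P) (e, true)) then 1 else 2.

(* Packaged deletion, as a relation "P' is (isomorphic to) P \ e".       *)
(*  ie : edges of P' = edges of P other than e;                          *)
(*  iv : vertices of P' = vertices of P;                                 *)
(*  jf : boundary components of P' -> Some f for the components f of P   *)
(*       not meeting e (natural correspondence), None for the new ones.  *)
Definition is_deletion (P : pkg) (e : redge (pg P)) (P' : pkg) : Prop :=
  let G := pg P in let G' := pg P' in
  exists (ie : redge G' -> redge G) (iv : rvert G' -> rvert G)
         (jf : rface G' -> option (rface G)),
  let ied := fun d : redge G' * bool => (ie d.1, d.2) in
  let De := [set d : redge G * bool | d.1 != e] in
  let f0 := rfx G (e, false) in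
  let g0 := rfx G (e, true) in
  let meets := fun f => (f0 == f) || (g0 == f) in
  let jf' := fun f' => if jf f' is Some f then f else f0 in
  let inB := fun f => (pf P f == pf P f0) || (pf P f == pf P g0) in
  injective ie /\ (forall x, (x \in codom ie) = (x != e)) /\
  bijective iv /\
  (forall d, ied (rsigma G' d) = next_in (rsigma G) De (ied d)) /\
  (forall d, iv (rvx G' d) = rvx G (ied d)) /\
  (forall d, jf (rfx G' d) =
               (if meets (rfx G (ied d)) then None else Some (rfx G (ied d)))) /\
  (forall f1 f2 f, jf f1 = Some f -> jf f2 = Some f -> f1 = f2) /\
  (forall f, (exists f', jf f' = Some f) <-> ~~ meets f) /\
  (forall v1 v2, (pv P' v1 == pv P' v2) = (pv P (iv v1) == pv P (iv v2))) /\
  (forall v, wv P' (pv P' v) = wv P (pv P (iv v))) /\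
  (* boundary partition: new components go in the block of f0 / g0;
     in case (iii) the blocks [f0], [g0] are merged *)
  (forall f1 f2, (pf P' f1 == pf P' f2) =
       (pf P (jf' f1) == pf P (jf' f2)) || (inB (jf' f1) && inB (jf' f2))) /\
  (forall f, wf P' (pf P' f) =
       if inB (jf' f) then
         (if pf P f0 == pf P g0 then (wf P (pf P f0) + 1)%N
          else (wf P (pf P f0) + wf P (pf P g0))%N)
       else wf P (pf P (jf' f))).

(* Packaged contraction: P / e = (P^* \ e)^*, i.e. P'' is P / e iff its
   dual is the deletion of e from the dual of P. *)
Definition is_contraction (P : pkg) (e : redge (pg P)) (P' : pkg) : Prop :=
  @is_deletion (pdual P) e (pdual P').

Arguments eta : clear implicits.
Arguments mu : clear implicits.
Arguments is_deletion : clear implicits.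
Arguments is_contraction : clear implicits.
Arguments Tpoly {R} P x y xs ys.

(* Main.v *)
(* Proof idea.  Write T as a sum of terms indexed by A.  The terms with [e] not
   in A are, up to the factor in x, the terms of the deletion; those with [e]
   in A reduce to them by duality (exchange vertices and faces, x and y, and
   complement A).  For [e] not in A nothing changes on the vertex side.  On the
   face side, H := G*|A^c contains [e], and passing from G to G\e contracts [e]
   in H; contraction preserves the number of boundary components, and in each
   of the three cases the change of edges, blocks and weights cancels in g.
     Ribbon subgraphs are handled through first-return permutations
   [rstr rho D] (the rotation [rho] induced on the darts D).  If [phi] is the
   rotation of G*, the rotation of G*/e is the first return, off the darts of
   [e], of [contr e phi], i.e. [phi] precomposed with the swap of the two darts
   of [e].  The invariance of the boundary count then follows from the tower
   property of first returns and from counting the orbits contained in [e],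
   which become discs without darts. *)
Require Import Defs.
From mathcomp Require Import all_boot all_order all_algebra all_fingroup zify.
Set Implicit Arguments.
Unset Strict Implicit.
Unset Printing Implicit Defensive.
Import GRing.Theory.

(** * Generated relations, and comparison of the sizes of two images *)

Lemma connect_least (T : finType) (e : rel T) (r : T -> T -> Prop) :
  (forall x, r x x) -> (forall x y z, r x y -> r y z -> r x z) ->
  (forall x y, e x y -> r x y) -> forall x y, connect e x y -> r x y.
Proof.
move=> rr rt re x y /connectP[p]; elim: p x => [|z p IH] x /=; first by move=> _ ->.
by move=> /andP[exz pz] yE; apply: rt (re _ _ exz) (IH _ pz yE).
Qed.

(** The set [Q] of matching pairs of values projects injectively to both sides, since [f'] and [f]
    identify the same points. This compares orbit counts of permutations of different types. *)
Lemma card_imset_transport (A B A' B' : finType) (f : A -> B) (f' : A' -> B')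
    (h : A' -> A) (S : {set A}) (S' : {set A'}) :
  {in S', forall a, h a \in S} ->
  {in S, forall a, exists2 a', a' \in S' & f (h a') = f a} ->
  {in S' &, forall a b, (f' a == f' b) = (f (h a) == f (h b))} ->
  #|f' @: S'| = #|f @: S|.
Proof.
move=> hS fS ff'; pose Q := [set (f' a, f (h a)) | a in S'].
have fst_inj : {in Q &, injective fst}.
  move=> _ _ /imsetP[a aS ->] /imsetP[b bS ->] /= /eqP e.
  by congr pair; apply/eqP => //; rewrite -ff'.
have snd_inj : {in Q &, injective snd}.
  move=> _ _ /imsetP[a aS ->] /imsetP[b bS ->] /= /eqP e.
  by congr pair; apply/eqP => //; rewrite ff'.
have -> : f' @: S' = fst @: Q by rewrite -imset_comp.
rewrite (card_in_imset fst_inj) -(card_in_imset snd_inj) -imset_comp.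
apply: eq_card => z; apply/imsetP/imsetP => -[a aS ->].
  by exists (h a) => //; apply: hS.
by have [a' a'S <-] := fS a aS; exists a'.
Qed.

(** * First-return permutations *)

Section FirstReturn.
Variable T : finType.
Implicit Types (f b : {perm T}) (S U : {set T}).

(** Relational form of [next_in]: with no bound on the number of iterations, arguments go by
    induction along the return path. *)
Inductive first_ret (f : T -> T) (S : {set T}) : T -> T -> Prop :=
| First_ret_hit d : f d \in S -> first_ret f S d (f d)
| First_ret_skip d z : f d \notin S -> first_ret f S (f d) z -> first_ret f S d z.

Lemma first_ret_in (f : T -> T) S d z : first_ret f S d z -> z \in S.
Proof. by elim. Qed.

Lemma first_ret_fun (f : T -> T) S d z z' :
  first_ret f S d z -> first_ret f S d z' -> z = z'.
Proof.
move=> r; elim: r z' => {d z} [d dS|d z dS _ IH] z' r'.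
  by case: _ / r' dS => // d' y /negP + _ /[dup] /[swap].
by case: _ / r' dS IH => [d' -> //|d' y _ r' _]; apply.
Qed.

Lemma first_retE (f : T -> T) S d z : first_ret f S d z <->
  exists k, [/\ z = iter k.+1 f d, z \in S & forall j, j < k -> iter j.+1 f d \notin S].
Proof.
split.
  elim=> {d z} [d dS|d z dS _ [k [-> zS nS]]]; first by exists 0.
  exists k.+1; split=> //; first by rewrite -!iterSr.
  by case=> // j jk; rewrite iterSr; apply: nS.
case=> k; elim: k d z => [|k IH] d _ [-> zS nS]; first exact: First_ret_hit.
apply: First_ret_skip; first exact: (nS 0).
by rewrite iterSr; apply: IH; split; rewrite -?iterSr // => j jk; rewrite -iterSr; apply: nS.
Qed.

(** Cancelling the shorter return time presents one point as an iterate of the other; a positive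
    number of steps would be an earlier visit to [S]. *)
Lemma first_ret_inj (f : T -> T) S d d' z : injective f ->
  d \in S -> d' \in S -> first_ret f S d z -> first_ret f S d' z -> d = d'.
Proof.
move=> finj; wlog: d d' / exists k k', [/\ k <= k', z = iter k.+1 f d,
    z = iter k'.+1 f d' & forall j, j < k' -> iter j.+1 f d' \notin S].
  move=> W dS d'S r r'; move: (r) (r').
  move=> /first_retE[k [zk zS nk]] /first_retE[k' [zk' _ nk']].
  have [le|/ltnW le] := leqP k k'; first by apply: W => //; exists k, k'.
  by symmetry; apply: W => //; exists k', k.
move=> [k [k' [le zk zk' nk']]] dS d'S _ _.
have: d = iter (k' - k) f d'.
  move: zk; rewrite zk' -(subnKC le) -addSn iterD addKn.
  by elim: (k.+1) => //= i IH /finj.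
case E: (k' - k) => [|j] // dE.
have /nk' : j < k' by lia.
by rewrite -dE dS.
Qed.

(** The scan over [#|T|] iterates is long enough, because [d] recurs after its order, which is at
    most [#|T|]. Hence the default value of [head] is never taken. *)
Lemma next_in_first_ret f S d : d \in S -> first_ret f S d (next_in f S d).
Proof.
move=> dS; rewrite /next_in.
have: has (mem S) [seq iter k.+1 f d | k <- iota 0 #|T|].
  apply/hasP; exists d => //; apply/mapP; exists (fingraph.order f d).-1.
    by rewrite mem_iota /= add0n prednK ?order_gt0 // max_card.
  by rewrite prednK ?order_gt0 // iter_order //; apply: perm_inj.
suff: forall n x0 x, has (mem S) [seq iter k.+1 f x | k <- iota 0 n] ->
    first_ret f S x (head x0 [seq z <- [seq iter k.+1 f x | k <- iota 0 n] | z \in S]).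
  by apply.
move=> {dS d} n x0; elim: n => // n IH d.
have E : [seq iter k.+1 f d | k <- iota 0 n.+1]
       = f d :: [seq iter k.+1 f (f d) | k <- iota 0 n].
  rewrite /= (iotaDl 1 0) -map_comp; congr cons.
  by apply: eq_map => k /=; rewrite -iterSr.
rewrite E /=; case: ifP => [dS _|/negbT dS] /=; first exact: First_ret_hit.
by rewrite ?(negbTE dS) => /IH; apply: First_ret_skip.
Qed.

Fact rstr_inj f S : injective (fun d => if d \in S then next_in f S d else d).
Proof.
move=> d d'; have [dS|dS] := ifPn; have [d'S|d'S] := ifPn.
- move=> e; apply: (first_ret_inj (@perm_inj _ f) dS d'S (next_in_first_ret f dS)).
  by rewrite e; apply: next_in_first_ret.
- by move=> e; case/negP: d'S; rewrite -e; apply: first_ret_in (next_in_first_ret f dS).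
- by move=> e; case/negP: dS; rewrite e; apply: first_ret_in (next_in_first_ret f d'S).
- by [].
Qed.

(** Being the identity outside [S], the first return becomes a permutation of the whole type. *)
Definition rstr f S : {perm T} := perm (@rstr_inj f S).

Lemma rstr_in f S d : d \in S -> rstr f S d = next_in f S d.
Proof. by rewrite permE => ->. Qed.

Lemma rstr_notin f S d : d \notin S -> rstr f S d = d.
Proof. by rewrite permE => /negbTE ->. Qed.

Lemma rstr_first_ret f S d : d \in S -> first_ret f S d (rstr f S d).
Proof. by move=> dS; rewrite rstr_in //; apply: next_in_first_ret. Qed.

Lemma rstrE f S d z : d \in S -> first_ret f S d z -> rstr f S d = z.
Proof. by move=> /(rstr_first_ret f)/first_ret_fun; apply. Qed.

Lemma rstr_mem f S d : d \in S -> rstr f S d \in S.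
Proof. by move=> /(rstr_first_ret f)/first_ret_in. Qed.

(** The points skipped before [w] lie outside [U], hence outside [S], so the return to [S] is either
    [w] or the return from [w]. *)
Lemma first_ret_tower f S U d w z : S \subset U -> first_ret f U d w ->
  (w \in S -> w = z) -> (w \notin S -> first_ret f S w z) -> first_ret f S d z.
Proof.
move=> /subsetP SU; elim=> {d w} [d dU|d w dU _ IH].
  have [dS /(_ isT) <- _|dS _ /(_ isT)] := boolP (f d \in S).
    exact: First_ret_hit.
  exact: First_ret_skip.
by move=> h1 h2; apply: First_ret_skip (IH h1 h2); apply: contra dU; apply: SU.
Qed.

(** Tower property: each step on the return path of [rstr f U] expands into a stretch of the path of
    [f]. *)
Lemma rstr_rstr f S U : S \subset U -> rstr (rstr f U) S = rstr f S.
Proof.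
move=> SU; apply/permP => d.
have [dS|dS] := boolP (d \in S); last by rewrite !rstr_notin.
symmetry; apply: rstrE => //.
have := rstr_first_ret (rstr f U) dS.
have : d \in U by apply: (subsetP SU).
move: (rstr _ S d) => z /[swap].
elim=> {d dS z} [d dS|d z dS _ IH] dU.
  by apply: (first_ret_tower SU (rstr_first_ret f dU)) => //; rewrite dS.
apply: (first_ret_tower SU (rstr_first_ret f dU)); first by rewrite (negbTE dS).
by move=> _; apply: IH; apply: rstr_mem.
Qed.

(** [b] preserves [S] and fixes the points skipped on the way, so it acts only on the starting point
    of a return path. *)
Lemma rstr_mul f b S : (forall d, d \notin S -> b d = d) ->
  rstr (b * f)%g S = (b * rstr f S)%g.
Proof.
move=> bS.
have bS' d : d \in S -> b d \in S.
  by move=> dS; apply: contraLR dS => nS; rewrite -(perm_inj (bS _ nS)).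
apply/permP => d; rewrite permM.
have [dS|dS] := boolP (d \in S); last by rewrite !rstr_notin ?bS.
apply: rstrE => //; move: {dS} (rstr_first_ret f (bS' d dS)).
move: (rstr f S (b d)) => z; move E: (b d) => x r.
elim: r d E => {x z} [x xS|x z xS _ IH] d bd.
  by rewrite -bd -permM; apply: First_ret_hit; rewrite permM bd.
apply: First_ret_skip; first by rewrite permM bd.
by rewrite permM bd; apply: IH; apply: bS.
Qed.

Lemma porbit_iterP f d z : reflect (exists n, z = iter n f d) (z \in porbit f d).
Proof.
by apply: (iffP (porbitP _ _ _)) => -[n ->]; exists n; rewrite permX.
Qed.

Lemma mem_porbit_iter f d n : iter n f d \in porbit f d.
Proof. by apply/porbit_iterP; exists n. Qed.

Lemma porbit_stable f S d : (forall x, x \in S -> f x \in S) -> d \in S ->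
  porbit f d \subset S.
Proof.
move=> fS dS; apply/subsetP => _ /porbit_iterP[n ->].
by elim: n => //= n; apply: fS.
Qed.

Lemma porbit_step f d : porbit f (f d) = porbit f d.
Proof. by have := porbit_perm f 1 d; rewrite expg1. Qed.

Lemma first_ret_porbit f S d z : first_ret f S d z -> z \in porbit f d.
Proof. by move=> /first_retE[k [-> _ _]]; apply: mem_porbit_iter. Qed.

Lemma porbit_rstr f S d : d \in S -> porbit (rstr f S) d = porbit f d :&: S.
Proof.
move=> dS; apply/setP => z; rewrite inE; apply/idP/andP.
  move=> /porbit_iterP[n ->]; elim: n => [|n [IH nS]] /=; first by rewrite porbit_id.
  split; last exact: rstr_mem.
  by rewrite -eq_porbit_mem in IH; rewrite -(eqP IH) (first_ret_porbit (rstr_first_ret _ _)).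
case=> /porbit_iterP[n ->]; elim/ltn_ind: n d dS => n IH d dS zS.
(* The first return skips only points outside [S], so a later visit to [S] is reached from [w] in
   fewer steps; this drives the strong induction. *)
have step : forall d w k, first_ret f S d w -> iter k.+1 f d \in S ->
    exists2 m, m <= k & iter m f w = iter k.+1 f d.
  move=> x w k r; elim: r k => {x w} [x xS|x w xS _ IHr] k.
    by exists k => //; rewrite iterSr.
  rewrite iterSr; case: k => [|k] /=; first by rewrite (negbTE xS).
  by move=> /IHr[m mk e]; exists m => //; lia.
case: n IH zS => [|n] IH zS; first exact: porbit_id.
have [m mn mE] := step _ _ _ (rstr_first_ret f dS) zS.
rewrite -mE -porbit_step IH ?mE //; exact: rstr_mem.
Qed.

Lemma porbit_agree f b S d : {in S, f =1 b} -> porbit f d \subset S ->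
  porbit b d = porbit f d.
Proof.
move=> fb /subsetP oS.
have E n : iter n b d = iter n f d.
  by elim: n => //= n ->; rewrite fb // oS // mem_porbit_iter.
by apply/setP => z; apply/porbit_iterP/porbit_iterP => -[n ->]; exists n.
Qed.

Lemma porbit_eq_in f b S d : {in S, f =1 b} ->
  (forall x, x \in S -> f x \in S) -> d \in S -> porbit b d = porbit f d.
Proof. by move=> fb fS dS; apply: porbit_agree fb (porbit_stable fS dS). Qed.

Lemma porbit_fconnect f d : porbit f d = [set z | fconnect f d z].
Proof.
apply/setP => z; rewrite inE; apply/porbit_iterP/idP => [[n ->]|].
  exact: fconnect_iter.
by move=> /iter_findex <-; eexists.
Qed.

Lemma eq_porbit f d d' : (porbit f d == porbit f d') = fconnect f d d'.
Proof. by rewrite eq_porbit_mem porbit_sym porbit_fconnect inE. Qed.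

Lemma fconnect_porbit_in (g : T -> T) f S d : {in S, g =1 f} ->
  (forall x, x \in S -> f x \in S) -> d \in S ->
  [set z | fconnect g d z] = porbit f d.
Proof.
move=> gf fS dS.
have E n : iter n g d = iter n f d /\ iter n f d \in S.
  by elim: n => //= n [-> nS]; rewrite gf ?fS.
apply/setP => z; rewrite inE; apply/idP/porbit_iterP => [|[n ->]].
  by move=> /iter_findex <-; eexists; apply: (E _).1.
by rewrite -(E n).1 fconnect_iter.
Qed.

End FirstReturn.

(** * Comparison of first returns and orbits of two permutations *)

Lemma first_ret_eq_in (T : finType) (f g : {perm T}) (S U : {set T}) d z :
  {in U, f =1 g} -> (forall x, x \in U -> f x \in U) -> d \in U ->
  first_ret f S d z -> first_ret g S d z.
Proof.
move=> fg fU dU r; elim: r dU => {d z} [d dS|d z dS _ IH] dU.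
  by rewrite fg //; apply: First_ret_hit; rewrite -fg.
by apply: First_ret_skip; rewrite -fg //; apply: IH; apply: fU.
Qed.

Lemma rstr_eq_in (T : finType) (f g : {perm T}) (S U : {set T}) d :
  {in U, f =1 g} -> (forall x, x \in U -> f x \in U) -> S \subset U ->
  d \in S -> rstr f S d = rstr g S d.
Proof.
move=> fg fU SU dS; symmetry; apply: rstrE => //.
by apply: first_ret_eq_in fg fU (subsetP SU _ dS) _; apply: rstr_first_ret.
Qed.

Lemma rstr_transport (T T' : finType) (h : T' -> T) (f : {perm T}) (f' : {perm T'})
    (S : {set T}) (S' : {set T'}) :
  (forall d, h (f' d) = f (h d)) -> (forall d, (h d \in S) = (d \in S')) ->
  {in S', forall d, h (rstr f' S' d) = rstr f S (h d)}.
Proof.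
move=> hf hS d dS'; symmetry; apply: rstrE; first by rewrite hS.
move: (rstr_first_ret f' dS') => r; elim: r {dS'} => {d} [d dS|d z dS _ IH].
  by rewrite hf; apply: First_ret_hit; rewrite -hf hS.
by apply: First_ret_skip; rewrite -hf ?hS.
Qed.

Lemma porbit_transport (T T' : finType) (h : T' -> T) (f : {perm T}) (f' : {perm T'})
    (S' : {set T'}) : injective h ->
  {in S', forall d, h (f' d) = f (h d)} -> (forall d, d \in S' -> f' d \in S') ->
  {in S', forall a b, (porbit f' a == porbit f' b) = (porbit f (h a) == porbit f (h b))}.
Proof.
move=> hi hf f'S a aS b.
have E n : h (iter n f' a) = iter n f (h a) /\ iter n f' a \in S'.
  by elim: n => //= n [<- nS]; rewrite hf // f'S.
rewrite [in LHS]eq_sym [in RHS]eq_sym !eq_porbit_mem.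
apply/porbit_iterP/porbit_iterP => -[n e]; exists n; first by rewrite e (E n).1.
by apply: hi; rewrite e (E n).1.
Qed.

(** The orbit of a point of [U] either meets [S], and is already the orbit of a point of [S], or is
    disjoint from [S]. *)
Lemma card_porbit_setU (T : finType) (f : {perm T}) (S U : {set T}) :
  #|porbit f @: (S :|: U)| =
    #|porbit f @: S| + #|porbit f @: [set d in U | [disjoint porbit f d & S]]|.
Proof.
have -> : porbit f @: (S :|: U) =
    (porbit f @: S) :|: (porbit f @: [set d in U | [disjoint porbit f d & S]]).
  apply/setP => c; rewrite imsetU !inE; apply/orP/orP => -[]; try by left.
    case/imsetP=> d dU ->; have [D|] := boolP [disjoint porbit f d & S].
      by right; apply: imset_f; rewrite inE dU.
    case/pred0Pn => z /andP[/= zd zS]; left; apply/imsetP; exists z => //.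
    by apply/eqP; rewrite eq_sym eq_porbit_mem.
  by case/imsetP=> d; rewrite inE => /andP[dU _] ->; right; apply: imset_f.
rewrite cardsU; suff -> : (porbit f @: S) :&:
    (porbit f @: [set d in U | [disjoint porbit f d & S]]) = set0 by rewrite cards0 subn0.
apply/setP => c; rewrite !inE; apply/negP => /andP[/imsetP[d dS ->] /imsetP[d']].
rewrite inE => /andP[_ /pred0P D] e; move: (D d) => /=.
by rewrite dS andbT -e porbit_id.
Qed.

(** * Packaged graphs: block labels and components *)

Section Labels.
Variables (X : finType).
Implicit Types (p q : X -> nat) (C : {set X}).

Lemma mem_nlabels p C l : reflect (exists2 u, u \in C & l = p u) (l \in nlabels p C).
Proof.
rewrite mem_undup; apply: (iffP mapP) => -[u uC ->]; exists u => //.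
  by rewrite mem_enum in uC.
by rewrite mem_enum.
Qed.

Lemma nlabels_uniq p C : uniq (nlabels p C).
Proof. exact: undup_uniq. Qed.

(** Sums and counts over blocks depend on the partition alone, not on the names of the labels. *)
Lemma big_nlabels (R : Type) (op : R -> R -> R) (idx : R) p q C (F H : nat -> R) :
  {in C &, forall u v, (p u == p v) = (q u == q v)} ->
  {in C, forall u, F (p u) = H (q u)} ->
  \big[op/idx]_(l <- nlabels p C) F l = \big[op/idx]_(l <- nlabels q C) H l.
Proof.
move=> pq FH; rewrite /nlabels.
have: {subset enum C <= C} by move=> u; rewrite mem_enum.
elim: (enum C) => [|u s IH] sC; first by rewrite !big_nil.
have uC : u \in C by apply: sC; rewrite inE eqxx.
have {}IH := IH (fun v vs => sC v (@mem_behead _ (u :: s) v vs)).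
(* [undup] drops the head label exactly when it recurs later. This is read off the partition, so
   both labellings drop it together. *)
have -> : undup [seq p v | v <- u :: s] =
    if has (fun v => p u == p v) s then undup [seq p v | v <- s]
    else p u :: undup [seq p v | v <- s].
  rewrite /=; congr (if _ then _ else _); apply/mapP/hasP => -[v vs].
    by move=> ->; exists v.
  by move=> /eqP ->; exists v.
have -> : undup [seq q v | v <- u :: s] =
    if has (fun v => p u == p v) s then undup [seq q v | v <- s]
    else q u :: undup [seq q v | v <- s].
  rewrite /=; congr (if _ then _ else _); apply/mapP/hasP => -[v vs e]; exists v => //.
    by rewrite pq ?e // sC // inE vs orbT.
  by apply/eqP; rewrite -pq // sC // inE vs orbT.
by case: ifP => // _; rewrite !big_cons IH FH.
Qed.

Lemma size_nlabels p q C : {in C &, forall u v, (p u == p v) = (q u == q v)} ->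
  size (nlabels p C) = size (nlabels q C).
Proof. by move=> pq; rewrite -!sum1_size; apply: big_nlabels. Qed.

End Labels.

Lemma perm_nlabels (X X' : finType) (h : X' -> X) (p : X -> nat) (C : {set X}) (C' : {set X'}) :
  {in C', forall u, h u \in C} -> {in C, forall u, exists2 u', u' \in C' & p (h u') = p u} ->
  perm_eq (nlabels (p \o h) C') (nlabels p C).
Proof.
move=> hC Ch; apply: uniq_perm; rewrite ?nlabels_uniq // => l.
apply/mem_nlabels/mem_nlabels => -[u uC ->]; first by exists (h u); rewrite ?hC.
by have [u' u'C <-] := Ch u uC; exists u'.
Qed.

Section Components.
Variables (E X : finType) (lab : E * bool -> X) (p : X -> nat).
Implicit Types (A : {set E}) (C : {set X}) (u v w : X).

Definition joined A := connect (crel lab p A).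
Definition cls A u := [set w | joined A u w].

Lemma crel_sym A : symmetric (crel lab p A).
Proof.
move=> u w; rewrite /crel eq_sym; congr orb.
by apply: eq_existsb => x; rewrite orbC.
Qed.

Lemma joined_sym A : symmetric (joined A).
Proof. exact/sym_connect_sym/crel_sym. Qed.

Lemma joined_refl A u : joined A u u.
Proof. exact: connect0. Qed.

Lemma joined_trans A u v w : joined A u v -> joined A v w -> joined A u w.
Proof. exact: connect_trans. Qed.

Lemma joined_label A u v : p u = p v -> joined A u v.
Proof. by move=> e; apply: connect1; rewrite /crel e eqxx. Qed.

Lemma joined_edge A x b : x \in A -> joined A (lab (x, b)) (lab (x, ~~ b)).
Proof.
move=> xA; apply: connect1; apply/orP; right; apply/existsP; exists x.
by rewrite xA; case: b => /=; rewrite !eqxx ?orbT.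
Qed.

Lemma joined_least A (r : X -> X -> Prop) :
  (forall u, r u u) -> (forall u v, r u v -> r v u) ->
  (forall u v w, r u v -> r v w -> r u w) -> (forall u v, p u = p v -> r u v) ->
  (forall x, x \in A -> r (lab (x, false)) (lab (x, true))) ->
  forall u v, joined A u v -> r u v.
Proof.
move=> rr rs rt rp re; apply: connect_least => // u v.
case/orP => [/eqP/rp //|/existsP[x /andP[xA]]].
by case/orP => /andP[/eqP <- /eqP <-]; [|apply: rs]; apply: re.
Qed.

Lemma cls_eq A u v : (cls A u == cls A v) = joined A u v.
Proof.
apply/eqP/idP => [e|uv]; first by have := joined_refl A v; rewrite -[joined A v v]in_set -/(cls A v) -e inE.
apply/setP => w; rewrite !inE; exact: same_connect (joined_sym A) _ _ uv w.
Qed.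

Lemma compsE A : comps lab p A = cls A @: setT.
Proof. by apply/setP => C; apply/imsetP/imsetP => -[u _ ->]; exists u. Qed.

Lemma comps_cls A C u : C \in comps lab p A -> u \in C -> C = cls A u.
Proof. by rewrite compsE => /imsetP[w _ ->]; rewrite inE => wu; apply/eqP; rewrite cls_eq. Qed.

Lemma comps_closed A C u v : C \in comps lab p A -> joined A u v ->
  (u \in C) = (v \in C).
Proof.
rewrite compsE => /imsetP[w _ ->] uv; rewrite !inE.
by apply/idP/idP => wu; apply: joined_trans wu _; rewrite // joined_sym.
Qed.

(** The right-hand side is an equivalence relation, because [near] is a union of classes of [A]:
    adding [x] merges only the classes of its two ends. *)
Lemma joined_setU1 A x u v : let s := lab (x, false) in let t := lab (x, true) in
  let near w := joined A w s || joined A w t in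
  joined (x |: A) u v -> joined A u v \/ near u && near v.
Proof.
move=> s t near.
apply: (joined_least (r := fun u v => joined A u v \/ near u && near v)) => {u v} [u|u v|u v w|u v e|y].
- by left; apply: joined_refl.
- by case=> [uv|uv]; [left; rewrite joined_sym|right; rewrite andbC].
- have nearE u' v' : joined A u' v' -> near u' = near v'.
    move=> uv; rewrite /near; congr orb; exact: same_connect (joined_sym A) _ _ uv _.
  case=> [uv|/andP[nu nv]] [vw|/andP[nv' nw]].
  + by left; apply: joined_trans vw.
  + by right; rewrite (nearE _ _ uv) nv' nw.
  + by right; rewrite nu -(nearE _ _ vw).
  + by right; rewrite nu nw.
- by left; apply: joined_label.
- rewrite in_setU1 => /predU1P[->|yA]; last by left; apply: (joined_edge false).
  by right; rewrite /near !joined_refl orbT.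
Qed.

Lemma joined_mono A (B : {set E}) u v : A \subset B -> joined A u v -> joined B u v.
Proof.
move=> /subsetP AB; apply: (joined_least (r := fun u v => joined B u v)) => {u v} [u|u v|u v w|u v e|x xA].
- exact: joined_refl.
- by rewrite joined_sym.
- exact: joined_trans.
- exact: joined_label.
- exact/(joined_edge false)/AB.
Qed.

(** The class of the end [t] is set aside. Among the remaining points, [x |: A] and [A] join the
    same ones: two points near [x] are then both joined to the other end. *)
Lemma leq_comps_setU1 A x : #|comps lab p A| <= #|comps lab p (x |: A)|.+1.
Proof.
rewrite !compsE; set t := lab (x, true).
rewrite (cardsD1 (cls A t)) imset_f ?inE // add1n ltnS.
pose N := [set u | ~~ joined A u t].
have -> : cls A @: setT :\ cls A t = cls A @: N.
  apply/setP => C; rewrite in_setD1; apply/andP/imsetP.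
    by case=> + /imsetP[u _ e]; rewrite e cls_eq => ut; exists u; rewrite ?inE.
  by case=> u; rewrite inE => ut ->; rewrite cls_eq imset_f.
rewrite (@card_imset_transport _ _ _ _ (cls (x |: A)) (cls A) id N N) //.
- by apply/subset_leq_card/imsetS/subsetT.
- by move=> u uN; exists u.
move=> u v; rewrite !inE => uN vN; rewrite !cls_eq; apply/idP/idP.
  by apply: joined_mono; apply: subsetUr.
case/joined_setU1 => //; rewrite (negbTE uN) (negbTE vN) !orbF => /andP[us vs].
by apply: joined_trans us _; rewrite joined_sym.
Qed.

Lemma joined_set0 u v : joined set0 u v = (p u == p v).
Proof.
apply/idP/eqP; last exact: joined_label.
apply: (joined_least (r := fun u v => p u = p v)) => {u v} // [u v w -> //|x]; by rewrite inE.
Qed.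

Lemma perm_comps_set0 : perm_eq (enum (comps lab p set0))
  [seq [set u | p u == l] | l <- nlabels p setT].
Proof.
apply: uniq_perm; first exact: enum_uniq.
  rewrite map_inj_in_uniq ?nlabels_uniq // => l l' /mem_nlabels[u _ ->] _ /setP/(_ u).
  by rewrite !inE eqxx => /esym/eqP.
have clsE u : cls set0 u = [set v | p v == p u].
  by apply/setP => v; rewrite !inE joined_set0 eq_sym.
move=> C; rewrite mem_enum compsE; apply/imsetP/mapP.
  by case=> u _ ->; exists (p u); rewrite ?clsE //; apply/mem_nlabels; exists u.
by case=> _ /mem_nlabels[u _ ->] ->; exists u; rewrite ?clsE.
Qed.

Lemma card_comps_set0 : #|comps lab p set0| = size (nlabels p setT).
Proof. by rewrite cardE (perm_size perm_comps_set0) size_map. Qed.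

(** This makes the truncated subtraction in [nullity] exact. *)
Lemma leq_nlabels_comps A : size (nlabels p setT) <= #|A| + #|comps lab p A|.
Proof.
rewrite -card_comps_set0; have [n] := ubnP #|A|; elim: n A => // n IH A.
have [-> _|[x xA]] := set_0Vmem A; first by rewrite cards0.
rewrite -(setD1K xA) cardsU1 !inE eqxx /= ltnS => An.
apply: leq_trans (IH _ An) _.
by rewrite (addnC 1) -addnA leq_add2l add1n leq_comps_setU1.
Qed.

End Components.

(** * Transport of components along a map of vertices *)

Section ComponentTransport.
Variables (E X E' X' : finType) (lab : E * bool -> X) (p : X -> nat) (A : {set E}).
Variables (lab' : E' * bool -> X') (p' : X' -> nat) (A' : {set E'}) (h : X' -> X).
Hypothesis joined_h : forall u v, joined lab' p' A' u v = joined lab p A (h u) (h v).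
Hypothesis h_surj : forall u, exists u', joined lab p A u (h u').

(** It is enough that [h] hits every component: on faces it sends all new ones to [f0], so it misses
    [g0] when the two differ. *)
Lemma comps_transport : comps lab' p' A' = (fun C : {set X} => h @^-1: C) @: comps lab p A.
Proof.
have preim_cls u u' : joined lab p A u (h u') ->
    h @^-1: cls lab p A u = cls lab' p' A' u'.
  move=> uu'; apply/setP => v; rewrite !inE joined_h.
  exact: same_connect (joined_sym _ _ _) _ _ uu' _.
rewrite !compsE -imset_comp; apply/setP => C; apply/imsetP/imsetP => -[u _ ->].
  by exists (h u); rewrite //= (preim_cls _ _ (joined_refl _ _ _ _)).
by have [u' /preim_cls uu'] := h_surj u; exists u'.
Qed.

Lemma preim_comps_inj : {in comps lab p A &, injective (fun C : {set X} => h @^-1: C)}.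
Proof.
move=> C D CA; rewrite compsE => /imsetP[u _ ->] e; have [u' uu'] := h_surj u.
apply/esym/eqP; rewrite (comps_cls CA (u := h u')) ?cls_eq //.
by move/setP/(_ u'): e; rewrite !inE uu'.
Qed.

Lemma card_comps_transport : #|comps lab' p' A'| = #|comps lab p A|.
Proof. by rewrite comps_transport (card_in_imset preim_comps_inj). Qed.

Lemma big_comps_transport (R : Type) (idx : R) (op : Monoid.com_law idx)
    (F : {set X'} -> R) (H : {set X} -> R) :
  {in comps lab p A, forall C : {set X}, F (h @^-1: C) = H C} ->
  \big[op/idx]_(C in comps lab' p' A') F C = \big[op/idx]_(C in comps lab p A) H C.
Proof.
move=> FH; rewrite comps_transport big_imset /=; last exact: preim_comps_inj.
exact: eq_bigr.
Qed.

End ComponentTransport.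

(** * Boundary components *)

Definition darts (E : finType) (S : {set E}) := [set d : E * bool | d.1 \in S].
Definition flip (E : finType) : {perm E * bool} := perm (@flipd_inj E).
(** In the ribbon subgraph with darts [D] such a vertex is an isolated disc and contributes one
    boundary component. *)
Definition untouched (E X : finType) (lab : E * bool -> X) (D : {set E * bool}) :=
  [set x | [forall d in D, lab d != x]].

Lemma flipE (E : finType) d : flip E d = flipd d.
Proof. exact: permE. Qed.

Lemma flipK (E : finType) : (flip E * flip E = 1)%g.
Proof.
by apply/permP => -[x b]; rewrite permM !flipE perm1 /flipd /= negbK.
Qed.

Lemma flip_darts (E : finType) (S : {set E}) d : (flip E d \in darts S) = (d \in darts S).
Proof. by rewrite flipE !inE. Qed.

(* The orbits on [D] are the boundary components of the sub ribbon graph with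
   darts [D] that meet an edge. *)
Definition face_perm (E : finType) (rho : {perm E * bool}) (D : {set E * bool}) :=
  (flip E * rstr rho D)%g.

Lemma face_perm_darts (E : finType) (rho : {perm E * bool}) (S : {set E}) d :
  d \in darts S -> face_perm rho (darts S) d \in darts S.
Proof. by move=> dS; rewrite permM rstr_mem // flip_darts. Qed.

(** [next_in] and [rstr] are only known to agree on the darts of [S]; since [face_perm] preserves
    these, the orbits agree. *)
Lemma nboundE (E X : finType) (rho : {perm E * bool}) (lab : E * bool -> X) C S :
  nbound rho lab C S = #|porbit (face_perm rho (darts S)) @: darts S|
                       + #|C :&: untouched lab (darts S)|.
Proof.
rewrite /nbound -/(darts S); congr (_ + _); last first.
  by apply: eq_card => x; rewrite !inE.
congr #|pred_of_set _|; apply: eq_in_imset => d dS.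
apply: fconnect_porbit_in dS => [z zS|z]; last exact: face_perm_darts.
by rewrite permM rstr_in ?flip_darts // flipE.
Qed.

(** * Contraction of an edge in a rotation *)

Section Contraction.
Variables (E : finType) (e : E) (phi : {perm E * bool}).

(* If [phi] is the vertex rotation, the vertex rotation after contracting [e] is
   the first return of [contr] to the other darts, see [rstr_contr]. *)
Definition contr : {perm E * bool} := (tperm (e, false) (e, true) * phi)%g.

Lemma contr_out d : d.1 != e -> contr d = phi d.
Proof.
by case: d => x b xe; rewrite permM tpermD // xpair_eqE negb_and eq_sym xe.
Qed.

Lemma contr_in d : d.1 = e -> contr d = phi (flip E d).
Proof. by case: d => x [] /= ->; rewrite permM flipE ?tpermL ?tpermR. Qed.

(** The swap of the darts of [e] followed by [flip] fixes the darts of [e] and is [flip] elsewhere,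
    so [rstr_mul] pulls it out of the first return. The right-hand side is the face rotation
    obtained by deleting [e] from the vertex rotation [flip * phi]. *)
Lemma rstr_contr d : d.1 != e ->
  rstr contr (darts [set~ e]) d = rstr (flip E * phi)%g (darts [set~ e]) (flip E d).
Proof.
move=> de; have -> : contr = (tperm (e, false) (e, true) * flip E * (flip E * phi))%g.
  by rewrite -mulgA (mulgA (flip E)) flipK mul1g.
rewrite [in LHS]rstr_mul => [|[x b]].
  by rewrite !permM tpermD //; case: d de => x b xe; rewrite xpair_eqE negb_and eq_sym xe.
by rewrite !inE /= negbK permM flipE => /eqP ->; case: b; rewrite ?tpermL ?tpermR.
Qed.

Lemma rstr_contr_setU (S : {set E}) d :
  rstr contr (darts (e |: S)) d = rstr phi (darts (e |: S)) (tperm (e, false) (e, true) d).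
Proof.
rewrite rstr_mul ?permM // => -[x b]; rewrite !inE negb_or => /andP[xe _].
by rewrite tpermD // xpair_eqE negb_and eq_sym xe.
Qed.

(* Passing to a sub ribbon graph commutes with contracting [e]. *)
Lemma rstr_face_perm (S : {set E}) : e \notin S ->
  {in darts S, rstr (face_perm phi (darts (e |: S))) (darts S) =1 face_perm contr (darts S)}.
Proof.
move=> eS d dS.
have SU : darts S \subset darts (e |: S).
  by apply/subsetP => -[x b]; rewrite !inE /= orbC => ->.
have ne x : x \in darts S -> x.1 != e.
  by rewrite inE; apply: contraL => /eqP ->.
pose flipS := rstr (flip E) (darts S).
have flipSE x : x \in darts S -> flipS x = flip E x.
  by move=> xS; apply: rstrE => //; apply: First_ret_hit; rewrite flip_darts.
(* On the darts of [e] the swap in [contr] does the work of [flip], so there [flipS] may be the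
   identity. It is then supported on the darts of [S], as [rstr_mul] requires. *)
transitivity (rstr (flipS * rstr contr (darts (e |: S)))%g (darts S) d).
  apply: rstr_eq_in SU dS => [x|x]; last exact: face_perm_darts.
  rewrite !permM rstr_contr_setU => xU; congr (rstr _ _ _).
  have [xS|xS] := boolP (x \in darts S).
    rewrite flipSE // tpermD //; apply: contraTneq (ne _ xS);
      by rewrite flipE /flipd => -[->]; rewrite eqxx.
  rewrite /flipS rstr_notin // flipE.
  move: xU xS; case: x => x b; rewrite !inE /= => /orP[/eqP ->|->] // _.
  by case: b; rewrite ?tpermL ?tpermR.
rewrite rstr_mul => [|x]; last exact: rstr_notin.
by rewrite permM flipSE // rstr_rstr // permM.
Qed.

End Contraction.

Lemma untouched_setT (E X : finType) (lab : E * bool -> X) :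
  untouched lab (darts setT) = [set x | x \notin codom lab].
Proof.
apply/setP => x; rewrite !inE; apply/forall_inP/idP => [H|H d _].
  by apply/negP => /codomP[d xE]; move: (H d); rewrite !inE xE eqxx => /(_ isT).
by apply: contra H => /eqP <-; apply: codom_f.
Qed.

Lemma rsigma_rphi G : rsigma G = (flip _ * rphi G)%g.
Proof. by rewrite mulgA flipK mul1g. Qed.

(** * The deletion of an edge *)

Section StateSum.
Local Open Scope ring_scope.
Variables (R : comPzRingType) (P : pkg) (x y : R) (xs ys : int -> R).

Definition Tterm (A : {set redge (pg P)}) : R :=
  x ^+ nullity (rfx (pg P)) (pf P) (~: A) * y ^+ nullity (rvx (pg P)) (pv P) A
  * \prod_(C in comps (rfx (pg P)) (pf P) (~: A))
      xs (gidx (rphi (pg P)) (rfx (pg P)) (pf P) (wf P) (~: A) C)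
  * \prod_(C in comps (rvx (pg P)) (pv P) A)
      ys (gidx (rsigma (pg P)) (rvx (pg P)) (pv P) (wv P) A C).

Lemma TpolyE : Tpoly P x y xs ys = \sum_(A : {set redge (pg P)}) Tterm A.
Proof. by []. Qed.

End StateSum.
Arguments Tterm {R} P x y xs ys A.

Section Deletion.
Variables (P P' : pkg) (e : redge (pg P)).
Local Notation G := (pg P).
Local Notation G' := (pg P').
Hypotheses (okP : rg_ok G) (okP' : rg_ok G').
Variables (ie : redge G' -> redge G) (iv : rvert G' -> rvert G).
Variable jf : rface G' -> option (rface G).
Let ied (d : redge G' * bool) := (ie d.1, d.2).
Let f0 := rfx G (e, false).
Let g0 := rfx G (e, true).
Let meets f := (f0 == f) || (g0 == f).
(** A new face has no counterpart in [P]; [f0] stands for it, and lies in a block that the new face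
    inherits. *)
Let h f' := if jf f' is Some f then f else f0.
Let inB f := (pf P f == pf P f0) || (pf P f == pf P g0).
Hypothesis ie_inj : injective ie.
Hypothesis codom_ie : forall x, (x \in codom ie) = (x != e).
Hypothesis iv_bij : bijective iv.
Hypothesis ied_sigma : forall d,
  ied (rsigma G' d) = next_in (rsigma G) (darts [set~ e]) (ied d).
Hypothesis iv_rvx : forall d, iv (rvx G' d) = rvx G (ied d).
Hypothesis jf_rfx : forall d,
  jf (rfx G' d) = (if meets (rfx G (ied d)) then None else Some (rfx G (ied d))).
Hypothesis jf_inj : forall f1 f2 f, jf f1 = Some f -> jf f2 = Some f -> f1 = f2.
Hypothesis jf_surj : forall f, (exists f', jf f' = Some f) <-> ~~ meets f.
Hypothesis pv_iv : forall v1 v2, (pv P' v1 == pv P' v2) = (pv P (iv v1) == pv P (iv v2)).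
Hypothesis wv_iv : forall v, wv P' (pv P' v) = wv P (pv P (iv v)).
Hypothesis pf_h : forall f1 f2, (pf P' f1 == pf P' f2) =
  (pf P (h f1) == pf P (h f2)) || (inB (h f1) && inB (h f2)).
Hypothesis wf_h : forall f, wf P' (pf P' f) =
  if inB (h f) then
    (if pf P f0 == pf P g0 then (wf P (pf P f0) + 1)%N
     else (wf P (pf P f0) + wf P (pf P g0))%N)
  else wf P (pf P (h f)).

Local Notation phi := (rphi G).
Local Notation M := (contr e (rphi G)).
Local Notation de := (darts [set e]).
Local Notation De := (darts [set~ e]).

(** * Darts and rotations of the deletion *)

Lemma ied_inj : injective ied.
Proof. by move=> [x b] [y c] [/ie_inj -> ->]. Qed.

Lemma ie_neq x : ie x != e.
Proof. by rewrite -codom_ie codom_f. Qed.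

Lemma ied_out d : ied d \in De.
Proof. by rewrite !inE ie_neq. Qed.

Lemma ied_surj d : d.1 != e -> exists d', d = ied d'.
Proof.
by case: d => x b /=; rewrite -codom_ie => /codomP[x' ->]; exists (x', b).
Qed.

Lemma ied_darts (S' : {set redge G'}) d : (ied d \in darts (ie @: S')) = (d \in darts S').
Proof. by rewrite !inE /ied /= mem_imset. Qed.

Lemma ied_dartsP (S' : {set redge G'}) d :
  reflect (exists2 d', d' \in darts S' & d = ied d') (d \in darts (ie @: S')).
Proof.
apply: (iffP idP) => [|[d' dS ->]]; last by rewrite ied_darts.
by case: d => x b; rewrite inE => /imsetP[y yS /= ->]; exists (y, b); rewrite ?inE.
Qed.

Lemma ied_flip d : ied (flip _ d) = flip _ (ied d).
Proof. by rewrite !flipE. Qed.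

Lemma ied_rsigma d : ied (rsigma G' d) = rstr (rsigma G) De (ied d).
Proof. by rewrite ied_sigma rstr_in // ied_out. Qed.

(** Deleting [e] from the vertex rotation amounts to contracting it in the face rotation. *)
Lemma ied_rphi d : ied (rphi G' d) = rstr M De (ied d).
Proof.
rewrite rstr_contr ?ie_neq // -rsigma_rphi -ied_flip -ied_rsigma.
by rewrite permM.
Qed.

Lemma imset_ie_out (S' : {set redge G'}) : darts (ie @: S') \subset De.
Proof. by apply/subsetP => d /ied_dartsP[d' _ ->]; apply: ied_out. Qed.

(** Stated for a general rotation because it serves on both sides: with [rsigma G] for vertices and
    with [contr e phi] for faces. *)
Lemma card_face_orbits (rho : {perm redge G * bool}) (rho' : {perm redge G' * bool})
    (S' : {set redge G'}) : (forall d, ied (rho' d) = rstr rho De (ied d)) ->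
  #|porbit (face_perm rho' (darts S')) @: darts S'| =
  #|porbit (face_perm rho (darts (ie @: S'))) @: darts (ie @: S')|.
Proof.
move=> rhoE; apply: (@card_imset_transport _ _ _ _ _ _ ied).
- by move=> d; rewrite ied_darts.
- by move=> d /ied_dartsP[d' d'S ->]; exists d'.
move=> a b aS bS; apply: (porbit_transport ied_inj _ _ aS) => d dS.
  rewrite !permM (rstr_transport rhoE (ied_darts S')) ?flip_darts //.
  by rewrite rstr_rstr ?imset_ie_out // ied_flip.
exact: face_perm_darts.
Qed.

(** * Faces of the deletion and their boundary counts *)

Lemma rfx_eq a b : (rfx G a == rfx G b) = (porbit phi a == porbit phi b).
Proof. by have [_ -> _] := okP; rewrite eq_porbit. Qed.

Lemma rfx_rphi d : rfx G (phi d) = rfx G d.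
Proof. by apply/eqP; rewrite rfx_eq porbit_step. Qed.

Lemma meets_e b : meets (rfx G (e, b)).
Proof. by rewrite /meets; case: b; rewrite eqxx ?orbT. Qed.

(** [contr e phi] differs from [phi] only at darts of [e], and these all lie on faces meeting
    [e]. *)
Lemma meets_contr d : meets (rfx G (M d)) = meets (rfx G d).
Proof.
have [/eqP de|de] := boolP (d.1 == e); last by rewrite contr_out // rfx_rphi.
by rewrite contr_in // rfx_rphi flipE; case: d de => x b /= ->; rewrite !meets_e.
Qed.

Lemma meets_porbit d d' : d' \in porbit M d -> meets (rfx G d') = meets (rfx G d).
Proof. by move=> /porbit_iterP[n ->]; elim: n => //= n; rewrite meets_contr. Qed.

(** Until the [phi]-orbit of [d] first reaches a dart of [e], the contracted rotation follows the
    same path. *)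
Lemma meets_porbitP d :
  reflect (exists2 x, x \in de & x \in porbit M d) (meets (rfx G d)).
Proof.
apply: (iffP idP) => [md|[x]]; last first.
  by rewrite !inE => /eqP xe /meets_porbit <-; case: x xe => x b /= ->; apply: meets_e.
have [n [b]] : exists n b, iter n phi d = (e, b).
  case/orP: md; rewrite rfx_eq eq_sym eq_porbit_mem porbit_sym => /porbit_iterP[n nE];
  by exists n; eexists; rewrite -nE.
elim: n d {md} => [|n IH] d.
  by move=> /= ->; exists (e, b); rewrite ?porbit_id // !inE.
rewrite iterSr => nE; have [|de'] := boolP (d \in de).
  by exists d; rewrite ?porbit_id.
have [x xe xo] := IH _ nE; exists x => //.
by move: xo; rewrite -(contr_out (e := e)) ?porbit_step //; rewrite !inE in de'.
Qed.

Lemma rfx'_eq a b : (rfx G' a == rfx G' b) = (porbit M (ied a) == porbit M (ied b)).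
Proof.
have [_ -> _] := okP'; rewrite -eq_porbit.
have [h1 h2] : {in setT, forall d, ied (rphi G' d) = rstr M De (ied d)} /\
    (forall d, d \in setT -> rphi G' d \in setT) by split=> d //; rewrite ied_rphi.
rewrite (porbit_transport ied_inj h1 h2 (in_setT a) b) !eq_porbit_mem.
by rewrite porbit_rstr ?ied_out // inE ied_out andbT.
Qed.

(* The new faces are those with [jf f' = None]. *)
Lemma card_old_faces (C : {set rface G}) (S' : {set redge G'}) :
  #|[set f' | jf f' != None] :&: (h @^-1: C) :&: untouched (rfx G') (darts S')| =
  #|[set f | ~~ meets f] :&: C :&: untouched (rfx G) (darts (ie @: S'))|.
Proof.
rewrite -(card_in_imset (f := h)); last first.
  move=> f1 f2; rewrite !inE /h => /andP[/andP[+ _] _] /andP[/andP[+ _] _].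
  case E1: (jf f1) => [f|] // _; case E2: (jf f2) => [f'|] // _ e'.
  by apply: jf_inj E1 _; rewrite e'.
have unt f' f : jf f' = Some f -> (f' \in untouched (rfx G') (darts S')) =
    (f \in untouched (rfx G) (darts (ie @: S'))).
  move=> f'E; rewrite !inE; apply/forall_inP/forall_inP => H d.
    case/ied_dartsP=> d' /H nf ->; apply: contraNneq nf => fE.
    have nm : ~~ meets f by apply/jf_surj; exists f'.
    by apply/eqP/(jf_inj _ f'E); rewrite jf_rfx fE (negbTE nm).
  rewrite -ied_darts => /H; apply: contraNneq => f'd.
  by move: f'E; rewrite -f'd jf_rfx; case: ifP => // _ [->].
apply: eq_card => f; apply/imsetP/idP; rewrite 2!in_setI.
  case=> f' + ->; rewrite 2!in_setI => /andP[/andP[]]; rewrite inE [f' \in _ @^-1: _]inE /h.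
  case E: (jf f') => [g|] //= _ gC u.
  by rewrite -(unt _ _ E) u gC inE !andbT; apply/jf_surj; exists f'.
case/andP=> /andP[]; rewrite {1}in_set => /jf_surj[f' E] fC u.
exists f'; last by rewrite /h E.
by rewrite 2!in_setI (unt _ _ E) u !inE /h E fC.
Qed.

Lemma imset_ie_setT : darts (ie @: [set: redge G']) = De.
Proof.
apply/setP => d; apply/ied_dartsP/idP => [[d' _ ->]|]; first exact: ied_out.
by rewrite !inE => /ied_surj[d' ->]; exists d'; rewrite ?inE.
Qed.

Lemma contr_rsigma : {in de, M =1 rsigma G}.
Proof. by move=> d; rewrite !inE => /eqP dE; rewrite contr_in // [in RHS]rsigma_rphi [RHS]permM. Qed.

Lemma rvx_eq a b : (rvx G a == rvx G b) = (porbit (rsigma G) a == porbit (rsigma G) b).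
Proof. by have [-> _ _] := okP; rewrite eq_porbit. Qed.

(** Deletion isolates exactly the vertices all of whose darts belong to [e]. On those darts the
    contracted rotation equals [rsigma G], so such vertices are its orbits contained in [e]. *)
Lemma card_new_isolated_vertices :
  #|[set v | v \notin codom (rvx G')]| =
  #|[set v | v \notin codom (rvx G)]| + #|porbit M @: [set d in de | porbit M d \subset de]|.
Proof.
rewrite -(card_imset _ (bij_inj iv_bij)).
pose N := rvx G @: [set d in de | porbit M d \subset de].
have oE d : d \in de -> porbit M d \subset de = (porbit (rsigma G) d \subset de).
  move=> dE; apply/idP/idP => o.
    by rewrite (porbit_agree contr_rsigma o).
  have sM : {in de, rsigma G =1 M} by move=> x xE; rewrite contr_rsigma.
  by rewrite (porbit_agree sM o).
have <- : #|N| = #|porbit M @: [set d in de | porbit M d \subset de]|.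
  apply: (@card_imset_transport _ _ _ _ _ _ id) => // [d dE|a b]; first by exists d.
  rewrite !inE => /andP[_ oa] /andP[_ ob].
  by rewrite rvx_eq (porbit_agree contr_rsigma oa) (porbit_agree contr_rsigma ob).
have -> : iv @: [set v | v \notin codom (rvx G')] = [set v | v \notin codom (rvx G)] :|: N.
  have [vi ivK viK] := iv_bij.
  have cod v : (vi v \in codom (rvx G')) = [exists d in De, v == rvx G d].
    apply/codomP/exists_inP => -[d].
      by move=> dE; exists (ied d); rewrite ?ied_out // -iv_rvx -dE viK.
    rewrite !inE => /ied_surj[d' ->] /eqP dE; exists d'.
    by rewrite dE -iv_rvx ivK.
  apply/setP => v; rewrite -{1}(viK v) mem_imset; last exact: bij_inj iv_bij.
  rewrite in_setU !in_set cod.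
  have [/codomP[d vE]|nv] /= := boolP (v \in codom (rvx G)); last first.
    by apply/exists_inP => -[d _ /eqP dE]; rewrite dE codom_f in nv.
  apply/idP/imsetP => [/exists_inP H|[x]].
    have dde : d \in de.
      by apply: contra_notT H => dE; exists d; rewrite ?vE //; move: dE; rewrite !inE.
    exists d => //; rewrite inE dde oE //; apply/subsetP => x xd.
    apply: contra_notT H => xE; exists x; first by move: xE; rewrite !inE.
    by rewrite vE rvx_eq eq_porbit_mem porbit_sym.
  rewrite inE => /andP[xe]; rewrite oE // => /subsetP o xE; apply/exists_inP => -[z zE].
  rewrite xE rvx_eq eq_sym eq_porbit_mem => /o.
  by rewrite !inE in zE *; rewrite (negbTE zE).
rewrite cardsU; suff -> : [set v | v \notin codom (rvx G)] :&: N = set0.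
  by rewrite cards0 subn0.
apply/setP => v; rewrite !inE; apply/negP => /andP[+ /imsetP[d _ vE]].
by rewrite vE codom_f.
Qed.

(** [is_deletion] does not say how many new faces carry no dart. The number is forced by [rg_ok] for
    both graphs, which equates isolated vertices with faces without darts; the old faces without
    darts cancel. *)
Lemma card_new_isolated_faces :
  #|[set f' | jf f' == None] :&: [set f' | f' \notin codom (rfx G')]| =
  #|porbit M @: [set d in de | porbit M d \subset de]|.
Proof.
have [_ _ iso] := okP; have [_ _ iso'] := okP'.
have := card_new_isolated_vertices; rewrite iso iso'.
rewrite -(cardsID [set f' | jf f' == None]) setIC addnC => /eqP.
suff -> : #|[set f' | f' \notin codom (rfx G')] :\: [set f' | jf f' == None]| =
    #|[set f | f \notin codom (rfx G)]| by rewrite eqn_add2l => /eqP.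
have := card_old_faces setT setT; rewrite untouched_setT preimsetT !setIT imset_ie_setT => E.
transitivity #|[set f' | jf f' != None] :&: [set f' | f' \notin codom (rfx G')]|.
  by apply: eq_card => f; rewrite !inE.
rewrite E; apply: eq_card => f; rewrite !inE; apply/andP/idP.
  case=> nm /forall_inP u; apply/negP => /codomP[d fE]; move: nm; rewrite fE.
  have [de'|de'] := boolP (d \in De).
    by have := u _ de'; rewrite fE eqxx.
  by case: d {fE} de' => x b; rewrite !inE negbK => /eqP /= ->; rewrite meets_e.
move=> nf; split; last by apply/forall_inP => d _; apply: contraNneq nf => <-; apply: codom_f.
by apply: contra nf => /orP[] /eqP <-; apply: codom_f.
Qed.

(* Contracting [e] in the rotation [phi] turns the old faces meeting [e] into
   the orbits of [contr e phi] meeting [e]; those contained in [e] have become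
   faces without darts. *)
Lemma card_new_faces (S' : {set redge G'}) :
  #|[set f' | jf f' == None] :&: untouched (rfx G') (darts S')| =
  #|porbit M @: [set d in de | [disjoint porbit M d & darts (ie @: S')]]|.
Proof.
set DS := darts (ie @: S').
(* Orbits that leave [e] give new faces with darts; those contained in [e], collected in [Q2], give
   new faces without darts. *)
pose Q := [set d in de | [disjoint porbit M d & DS] && ~~ (porbit M d \subset de)].
pose Q2 := [set d in de | porbit M d \subset de].
have DSe d : porbit M d \subset de -> [disjoint porbit M d & DS].
  move=> /subsetP o; apply/pred0P => z; apply/negP => /andP[/= /o zd].
  by move/(subsetP (imset_ie_out S')); rewrite !inE in zd *; rewrite zd.
have -> : [set d in de | [disjoint porbit M d & DS]] = Q :|: Q2.
  apply/setP => d; rewrite in_setU ![d \in [set _ in de | _]]in_set.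
  case: (d \in de) => //=.
  by have := DSe d; case: (porbit M d \subset de) => [->|_]; rewrite ?andbT ?orbF ?orbT.
rewrite imsetU cardsU; have -> : porbit M @: Q :&: porbit M @: Q2 = set0.
  apply/setP => c; rewrite !inE; apply/negP => /andP[/imsetP[d dQ ->] /imsetP[d' d'Q e']].
  by move: dQ d'Q; rewrite !in_set e' => /and3P[_ _ /negbTE ->]; rewrite andbF.
rewrite cards0 subn0 -(cardsID [set f' | f' \in codom (rfx G')]); congr (_ + _); last first.
  rewrite -card_new_isolated_faces; apply: eq_card => f'.
  rewrite in_setD !in_setI !in_set; case cf: (f' \in codom _); rewrite ?andbF //= andbT.
  apply: andb_idr => _; apply/forall_inP => d _; apply: contraFneq cf => <-; apply: codom_f.
(* The orbits of [Q] are represented afresh by darts off [e], the only ones that come from darts of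
   the deletion. *)
pose Q' := [set d' | meets (rfx G (ied d')) && [disjoint porbit M (ied d') & DS]].
pose QD := [set d in De | meets (rfx G d) && [disjoint porbit M d & DS]].
have -> : porbit M @: Q = porbit M @: QD.
  apply/setP => c; apply/imsetP/imsetP => -[d]; rewrite inE => /and3P[dd].
    move=> D /subsetPn[x xd xe] ->; have xo : porbit M x = porbit M d.
      by apply/eqP; rewrite eq_porbit_mem.
    have xDe : x \in De by move: xe; rewrite !inE.
    exists x => //; rewrite in_set xDe xo D (meets_porbit xd) andbT /=.
    by move: dd; case: d {D xd xo} => y b; rewrite !inE => /eqP /= ->; rewrite meets_e.
  case/meets_porbitP => x xe xd D ->; have xo : porbit M x = porbit M d.
    by apply/eqP; rewrite eq_porbit_mem.
  exists x => //; rewrite inE xe xo D; apply/subsetPn; exists d; rewrite ?porbit_id //.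
  by move: dd; rewrite !inE.
rewrite -(@card_imset_transport _ _ _ _ (porbit M) (rfx G') ied QD Q').
- apply: eq_card => f'; apply/idP/imsetP.
    rewrite !inE => /andP[/andP[+ u] /codomP[d fE]]; rewrite {}fE in u *.
    rewrite jf_rfx; case: ifP => // md _; exists d => //; rewrite inE md.
    apply/pred0P => z; apply/negP => /andP[/= zd /ied_dartsP[z' z'S zE]].
    by have /forall_inP/(_ _ z'S)/negP[] := u; rewrite rfx'_eq -zE eq_porbit_mem.
  case=> d; rewrite inE => /andP[md /pred0P D] ->; rewrite !inE jf_rfx md codom_f eqxx andbT.
  apply/forall_inP => z zS; rewrite rfx'_eq eq_porbit_mem.
  by have /= := D (ied z); rewrite ied_darts zS andbT => ->.
- by move=> d; rewrite in_set => /andP[m D]; rewrite in_set ied_out m.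
- move=> d; rewrite in_set => /and3P[dDe m D].
  have [d' dE] : exists d', d = ied d' by apply: ied_surj; move: dDe; rewrite !inE.
  rewrite {}dE in m D *.
  by exists d'; rewrite // inE m.
- by move=> a b _ _; rewrite rfx'_eq.
Qed.

(** With no edges chosen, the orbit of a dart of [e] avoids the chosen darts trivially. The new face
    represents the merged block later on. *)
Lemma new_face : exists f', jf f' = None.
Proof.
suff: 0 < #|[set f' | jf f' == None] :&: untouched (rfx G') (darts set0)|.
  by case/card_gt0P=> f'; rewrite !inE => /andP[/eqP]; exists f'.
rewrite card_new_faces card_gt0; apply/set0Pn; exists (porbit M (e, true)).
apply: imset_f; rewrite !inE eqxx; apply/pred0P => z /=.
by rewrite imset0 !inE andbF.
Qed.

(** The contracted rotation agrees with [phi] on all darts of the faces in [C], and [phi] keeps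
    these darts among themselves. *)
Lemma nbound_face_avoid (C : {set rface G}) (S' : {set redge G'}) :
  f0 \notin C -> g0 \notin C -> (forall d, d \in darts (ie @: S') -> rfx G d \in C) ->
  nbound (rphi G') (rfx G') (h @^-1: C) S' = nbound phi (rfx G) C (ie @: S').
Proof.
move=> f0C g0C SC; rewrite !nboundE; congr (_ + _).
  rewrite (card_face_orbits _ ied_rphi); congr #|pred_of_set _|.
  apply: eq_in_imset => d; apply: porbit_eq_in; last exact: face_perm_darts.
  move=> x xS; rewrite !permM.
  (* Agreement on the darts of [S'] alone is not enough, as a first return may pass through other
     darts of the same face. *)
  apply: (@rstr_eq_in _ _ _ _ [set z | rfx G z \in C]); last by rewrite flip_darts.
  - case=> y b; rewrite inE => yC; rewrite contr_out //=; apply: contraTneq yC => ->.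
    by case: b.
  - by move=> z; rewrite !inE rfx_rphi.
  - by apply/subsetP => z /SC; rewrite inE.
have nm f : f \in C -> ~~ meets f.
  by move=> fC; apply/negP => /orP[] /eqP fE; rewrite -fE ?(negbTE f0C) ?(negbTE g0C) in fC.
transitivity #|[set f | ~~ meets f] :&: C :&: untouched (rfx G) (darts (ie @: S'))|.
  rewrite -card_old_faces; apply: eq_card => f'; rewrite !in_setI; congr (_ && _).
  by rewrite !inE /h; case: (jf f') => [f|] //=; apply/negbTE.
apply: eq_card => f; rewrite !in_setI !in_set; congr (_ && _).
by have := nm f; case: (f \in C) => [->|]; rewrite ?andbF.
Qed.

(** Contraction preserves the boundary count. Orbits meeting [S] correspond through their traces on
    [S], orbits living on [e] alone become new faces untouched by [S], and the old untouched faces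
    stay. *)
Lemma nbound_face_meet (C : {set rface G}) (S' : {set redge G'}) :
  f0 \in C -> g0 \in C ->
  nbound (rphi G') (rfx G') (h @^-1: C) S' = nbound phi (rfx G) C (e |: ie @: S').
Proof.
move=> f0C g0C; rewrite !nboundE (card_face_orbits _ ied_rphi).
set S := ie @: S'; set U := darts (e |: S).
have eS : e \notin S by apply/imsetP => -[x _ eE]; have := ie_neq x; rewrite -eE eqxx.
have UE : U = darts S :|: de by apply/setP => d; rewrite !inE orbC.
have deU : de \subset U by rewrite UE subsetUr.
have SU : darts S \subset U by rewrite UE subsetUl.
have face_agree : {in de, rstr M U =1 face_perm phi U}.
  move=> d; rewrite !inE => /eqP dE; rewrite rstr_contr_setU permM; congr (rstr _ _ _).
  by case: d dE => x b /= ->; case: b; rewrite flipE ?tpermL ?tpermR.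
(* Inside [U], an orbit is disjoint from [S] exactly when it is contained in [e], and on the darts
   of [e] the two permutations agree. *)
have orbM d : d \in de -> [disjoint porbit (face_perm phi U) d & darts S] =
    [disjoint porbit M d & darts S].
  have sub (f : {perm redge G * bool}) : (forall x, x \in U -> f x \in U) -> d \in de ->
      [disjoint porbit f d & darts S] = (porbit f d \subset de).
    move=> fU dd; have /subsetP oU := porbit_stable fU (subsetP deU _ dd).
    apply/idP/idP => [/pred0P D|/subsetP D].
      apply/subsetP => z zo; have := D z; have := oU z zo.
      by rewrite /= zo UE in_setU => /orP[->|].
    apply/pred0P => z; apply/negP => /andP[/= /D zd zS].
    by move: zd zS eS; rewrite !inE => /eqP -> ->.
  move=> dd; have dU : d \in U by apply: (subsetP deU).
  have -> : [disjoint porbit M d & darts S] = [disjoint porbit (rstr M U) d & darts S].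
    rewrite porbit_rstr // ![[disjoint _ & darts S]]disjoint_sym.
    by rewrite -!setI_eq0 setIA setIAC (setIidPl SU).
  rewrite !sub // => [|x xU|x xU]; last 2 first.
  - exact: rstr_mem.
  - exact: face_perm_darts.
  apply/idP/idP => o; last by rewrite (porbit_agree face_agree o).
  have face_agree' : {in de, face_perm phi U =1 rstr M U} by move=> x /face_agree.
  by rewrite (porbit_agree face_agree' o).
have -> : porbit (face_perm phi U) @: U = porbit (face_perm phi U) @: (darts S :|: de).
  by rewrite -UE.
(* Orbits meeting [S] are compared first; the orbits left over lie on [e] and are matched with
   untouched new faces. *)
rewrite card_porbit_setU -addnA; congr (_ + _).
  rewrite (@card_imset_transport _ _ _ _ (porbit (face_perm phi U))
    (porbit (face_perm M (darts S))) id (darts S) (darts S)) //.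
    by move=> a aS; exists a.
  move=> a b aS bS; have E x : x \in darts S ->
      porbit (face_perm M (darts S)) x = porbit (face_perm phi U) x :&: darts S.
    move=> xS; rewrite -porbit_rstr //; apply: porbit_eq_in xS => y yS.
      by rewrite /U rstr_face_perm.
    exact: rstr_mem.
  by rewrite !eq_porbit_mem E // inE aS andbT.
rewrite -(cardsID [set f' | jf f' == None]); congr (_ + _).
  transitivity #|[set f' | jf f' == None] :&: untouched (rfx G') (darts S')|.
    apply: eq_card => f'; rewrite !in_setI andbC; apply: andb_id2l; rewrite !inE /h.
    by move/eqP ->; rewrite f0C.
  rewrite card_new_faces -/S.
  have -> : [set d in de | [disjoint porbit (face_perm phi U) d & darts S]] =
      [set d in de | [disjoint porbit M d & darts S]].
    by apply/setP => d; rewrite [LHS]inE [RHS]inE; apply: andb_id2l; apply: orbM.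
  apply: (@card_imset_transport _ _ _ _ _ _ id) => // [d dd|a b]; first by exists d.
  rewrite !inE => /andP[ae oa] /andP[be ob].
  have E x : x.1 == e -> [disjoint porbit M x & darts S] ->
      porbit (face_perm phi U) x = porbit M x :&: U.
    move=> xe D; have xU : x \in U by apply: (subsetP deU); rewrite !inE.
    rewrite -porbit_rstr //; apply: porbit_agree face_agree _.
    rewrite porbit_rstr // UE setIUr; move: D; rewrite -setI_eq0 => /eqP ->.
    by rewrite set0U subsetIr.
  rewrite !eq_porbit_mem E // in_setI; suff -> : a \in U by rewrite andbT.
  by apply: (subsetP deU); rewrite !inE.
transitivity #|[set f | ~~ meets f] :&: C :&: untouched (rfx G) (darts S)|.
  rewrite -card_old_faces; apply: eq_card => f'; rewrite !in_setD !in_setI !in_set andbA.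
  by [].
apply: eq_card => f; rewrite !in_setI -andbA andbCA; congr (_ && _); rewrite !in_set.
apply/andP/forall_inP => [[nm /forall_inP u] d|u].
  rewrite UE in_setU => /orP[/u //|]; case: d => x b; rewrite !inE => /eqP /= ->.
  by apply: contra nm => /eqP <-; apply: meets_e.
split; last by apply/forall_inP => d /(subsetP SU)/u.
have eU b : (e, b) \in U by apply: (subsetP deU); rewrite !inE.
by apply/negP => /orP[] fE; [have := u _ (eU false)|have := u _ (eU true)] => /negP; apply.
Qed.

(** * The vertex side of the deletion *)

Lemma nbound_vertex (C : {set rvert G}) (S' : {set redge G'}) :
  nbound (rsigma G') (rvx G') (iv @^-1: C) S' = nbound (rsigma G) (rvx G) C (ie @: S').
Proof.
rewrite !nboundE (card_face_orbits _ ied_rsigma); congr (_ + _).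
rewrite -(card_imset _ (bij_inj iv_bij)); apply: eq_card => v.
have [vi ivK viK] := iv_bij.
rewrite -{1}(viK v) mem_imset; last exact: bij_inj iv_bij.
rewrite !in_setI inE viK; congr (_ && _); rewrite !in_set.
apply/forall_inP/forall_inP => u d.
  by case/ied_dartsP=> d' /u nv ->; apply: contraNneq nv => <-; rewrite -iv_rvx ivK.
rewrite -ied_darts => /u; apply: contraNneq => vE.
by rewrite -iv_rvx vE viK.
Qed.

Lemma joined_vertex (A' : {set redge G'}) u v :
  joined (rvx G') (pv P') A' u v = joined (rvx G) (pv P) (ie @: A') (iv u) (iv v).
Proof.
have [vi ivK viK] := iv_bij; apply/idP/idP.
  apply: (joined_least (r := fun u v => joined (rvx G) (pv P) (ie @: A') (iv u) (iv v))).
  - by move=> {}u; apply: joined_refl.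
  - by move=> {}u {}v; rewrite joined_sym.
  - by move=> {}u {}v w; apply: joined_trans.
  - by move=> {}u {}v /eqP; rewrite pv_iv => /eqP; apply: joined_label.
  - by move=> x xA; rewrite !iv_rvx; apply: (joined_edge _ _ false); apply: imset_f.
rewrite -{2}(ivK u) -{2}(ivK v).
apply: (joined_least (r := fun u v => joined (rvx G') (pv P') A' (vi u) (vi v))).
- by move=> {}u; apply: joined_refl.
- by move=> {}u {}v; rewrite joined_sym.
- by move=> {}u {}v w; apply: joined_trans.
- by move=> {}u {}v /eqP uv; apply: joined_label; apply/eqP; rewrite pv_iv !viK.
- move=> _ /imsetP[x xA ->]; rewrite -!/(ied (x, _)) -!iv_rvx !ivK.
  exact: (joined_edge _ _ false).
Qed.

Lemma vertex_surj (A' : {set redge G'}) u :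
  exists u', joined (rvx G) (pv P) (ie @: A') u (iv u').
Proof. by have [vi _ viK] := iv_bij; exists (vi u); rewrite viK joined_refl. Qed.

Lemma perm_nlabels_vertex (C : {set rvert G}) :
  perm_eq (nlabels (pv P \o iv) (iv @^-1: C)) (nlabels (pv P) C).
Proof.
have [vi _ viK] := iv_bij; apply: perm_nlabels => u; first by rewrite inE.
by move=> uC; exists (vi u); rewrite ?inE viK.
Qed.

Lemma size_nlabels_vertex (C : {set rvert G}) :
  size (nlabels (pv P') (iv @^-1: C)) = size (nlabels (pv P) C).
Proof.
rewrite -(perm_size (perm_nlabels_vertex C)); apply: size_nlabels => u v _ _.
exact: pv_iv.
Qed.

Lemma nullity_vertex (A' : {set redge G'}) :
  nullity (rvx G') (pv P') A' = nullity (rvx G) (pv P) (ie @: A').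
Proof.
rewrite /nullity (card_imset _ ie_inj) -size_nlabels_vertex preimsetT.
by rewrite (card_comps_transport (joined_vertex A') (vertex_surj A')).
Qed.

Lemma gidx_vertex (A' : {set redge G'}) (C : {set rvert G}) :
  gidx (rsigma G') (rvx G') (pv P') (wv P') A' (iv @^-1: C) =
  gidx (rsigma G) (rvx G) (pv P) (wv P) (ie @: A') C.
Proof.
rewrite /gidx size_nlabels_vertex nbound_vertex.
have -> : ie @: [set x in A' | rvx G' (x, false) \in iv @^-1: C] =
    [set x in ie @: A' | rvx G (x, false) \in C].
  apply/setP => x; apply/imsetP/idP => [[y]|].
    by rewrite !inE iv_rvx => /andP[yA yC] ->; rewrite imset_f.
  rewrite inE => /andP[/imsetP[y yA ->] yC]; exists y => //.
  by rewrite !inE iv_rvx yA.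
rewrite -(card_imset _ ie_inj); congr (Posz (_ + _ + _) - _)%R.
  congr #|pred_of_set _|; apply/setP => x; apply/imsetP/idP => [[y]|].
    by rewrite !inE iv_rvx => /andP[yA yC] ->; rewrite imset_f.
  rewrite inE => /andP[/imsetP[y yA ->] yC]; exists y => //.
  by rewrite !inE iv_rvx yA.
rewrite -(perm_big _ (perm_nlabels_vertex C)) /=; apply: big_nlabels => u => [v _ _|_].
  exact: pv_iv.
exact: wv_iv.
Qed.

(** * Blocks of faces after the deletion *)

(* Block labels and weights of the deletion, expressed with the labels of [P];
   when [e] meets two blocks, the merged block takes the label of [f0]. *)
Let q f' := if inB (h f') then pf P f0 else pf P (h f').
Let W l := if l == pf P f0 then
  (if pf P f0 == pf P g0 then (wf P (pf P f0) + 1)%N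
   else (wf P (pf P f0) + wf P (pf P g0))%N) else wf P l.

Lemma pf_merged f1 f2 : (pf P' f1 == pf P' f2) = (q f1 == q f2).
Proof.
have E f f' : inB f -> pf P f == pf P f' -> inB f'.
  by rewrite /inB => + /eqP <-.
have F f f' : inB f' = false -> (pf P f == pf P f') && inB f = false.
  by move=> nf; apply/negP => /andP[/E H /H]; rewrite nf.
rewrite pf_h /q; case b1: (inB (h f1)); case b2: (inB (h f2)); rewrite ?orbT ?orbF ?eqxx //.
  have /negbTE -> := contraFN (E _ (h f2) b1) b2.
  by apply/esym/negbTE/(contraFN (E _ (h f2) _) b2); rewrite /inB eqxx.
rewrite !(eq_sym (pf P (h f1))).
have /negbTE -> := contraFN (E _ (h f1) b2) b1.
by apply/esym/negbTE/(contraFN (E _ (h f1) _) b1); rewrite /inB eqxx.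
Qed.

Lemma wf_merged f : wf P' (pf P' f) = W (q f).
Proof.
rewrite wf_h /W /q; case b: (inB (h f)); first by rewrite eqxx.
by have := b; rewrite /inB; case: (pf P (h f) == pf P f0).
Qed.

Lemma h_new f' : jf f' = None -> h f' = f0.
Proof. by rewrite /h => ->. Qed.

Lemma inB_meets f : ~~ inB f -> ~~ meets f.
Proof. by apply: contra => /orP[] /eqP <-; rewrite /inB eqxx ?orbT. Qed.

Lemma h_old f : ~~ meets f -> exists f', h f' = f.
Proof. by move=> /jf_surj[f' E]; exists f'; rewrite /h E. Qed.

(** Merging loses only the label of [g0], and only if it differs from that of [f0]. The latter
    survives because a new face carries it, even when no old face of its block remains. *)
Lemma perm_nlabels_meet (C : {set rface G}) : f0 \in C -> g0 \in C ->
  perm_eq (nlabels (pf P) C)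
    ((if pf P f0 == pf P g0 then [::] else [:: pf P g0]) ++ nlabels q (h @^-1: C)).
Proof.
move=> f0C g0C; have q_mem l : l \in nlabels q (h @^-1: C) -> l \in nlabels (pf P) C.
  case/mem_nlabels => f'; rewrite inE /q => f'C ->; apply/mem_nlabels.
  by case: ifP => _; [exists f0|exists (h f')].
have q_g0 : pf P g0 \in nlabels q (h @^-1: C) -> pf P f0 == pf P g0.
  case/mem_nlabels => f' _; rewrite /q; case: ifPn => [_ -> //|nB e'].
  by move: nB; rewrite /inB -e' eqxx orbT.
apply: uniq_perm; first exact: nlabels_uniq.
  rewrite cat_uniq nlabels_uniq andbT; case: ifP => [_|/negbT fg]; first by rewrite /= has_pred0.
  apply/hasPn => l lq; rewrite inE; apply: contra fg => /eqP lE.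
  by apply: q_g0; rewrite -lE.
move=> l; rewrite mem_cat; apply/idP/orP => [/mem_nlabels[u uC ->]|[]]; last exact: q_mem.
  have [/orP[]/eqP uE|nu] := boolP (inB u); last first.
  - have [f' f'E] := h_old (inB_meets nu); right; apply/mem_nlabels; exists f'.
      by rewrite inE f'E.
    by rewrite /q f'E (negbTE nu).
  - rewrite uE; case: ifP => [/eqP fg|_]; last by left; rewrite inE.
    have [f' f'E] := new_face; right; rewrite -fg; apply/mem_nlabels; exists f'.
      by rewrite inE h_new.
    by rewrite /q h_new // /inB eqxx.
  have [f' f'E] := new_face; right; rewrite uE; apply/mem_nlabels; exists f'.
    by rewrite inE h_new.
  by rewrite /q h_new // /inB eqxx.
by case: ifP => // _; rewrite inE => /eqP ->; apply/mem_nlabels; exists g0.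
Qed.

Lemma perm_nlabels_avoid (C : {set rface G}) : {in C, forall u, ~~ inB u} ->
  perm_eq (nlabels (pf P) C) (nlabels q (h @^-1: C)).
Proof.
move=> CB; apply: uniq_perm; rewrite ?nlabels_uniq // => l.
apply/mem_nlabels/mem_nlabels => -[u uC ->].
  have [f' f'E] := h_old (inB_meets (CB u uC)); exists f'; first by rewrite inE f'E.
  by rewrite /q f'E (negbTE (CB u uC)).
by rewrite inE in uC; exists (h u); rewrite // /q (negbTE (CB _ uC)).
Qed.

Lemma size_nlabels_merged (C' : {set rface G'}) :
  size (nlabels (pf P') C') = size (nlabels q C').
Proof. by apply: size_nlabels => u v _ _; apply: pf_merged. Qed.

Lemma sum_nlabels_merged (C' : {set rface G'}) :
  \sum_(l <- nlabels (pf P') C') wf P' l = \sum_(l <- nlabels q C') W l.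
Proof. by apply: big_nlabels => u => [v _ _|_]; [apply: pf_merged|apply: wf_merged]. Qed.

(** * Components, nullity and genus on the face side *)

Section Edges.
Variable A' : {set redge G'}.
Local Notation A := (e |: ie @: A').
Local Notation joinedF := (joined (rfx G) (pf P) A).
Local Notation joinedF' := (joined (rfx G') (pf P') A').

Lemma joined_e b c : joinedF (rfx G (e, b)) (rfx G (e, c)).
Proof.
have := @joined_edge _ _ (rfx G) (pf P) A e b (setU11 _ _).
by case: b; case: c => // _; apply: joined_refl.
Qed.

Lemma joined_inB f : inB f -> joinedF f f0.
Proof.
case/orP=> /eqP fE; first exact: joined_label.
by apply: joined_trans (joined_label _ _ fE) _; apply: joined_e.
Qed.

Lemma meets_inB f : meets f -> inB f.
Proof. by case/orP=> /eqP <-; rewrite /inB eqxx ?orbT. Qed.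

Lemma h_rfx d : h (rfx G' d) = if meets (rfx G (ied d)) then f0 else rfx G (ied d).
Proof. by rewrite /h jf_rfx; case: ifP. Qed.

Lemma joined_h_rfx d : joinedF (h (rfx G' d)) (rfx G (ied d)).
Proof.
rewrite h_rfx; case: ifP => [/meets_inB/joined_inB|_]; last exact: joined_refl.
by rewrite joined_sym.
Qed.

(* The faces of the deletion whose block comes from that of [f]. *)
Let over f f' := (pf P f == pf P (h f')) || inB f && inB (h f').

Lemma over_ex f : exists f', over f f'.
Proof.
have [m|/h_old[f' f'E]] := boolP (meets f); last by exists f'; rewrite /over f'E eqxx.
have [f' f'E] := new_face; exists f'.
by rewrite /over h_new // (meets_inB m) /inB eqxx orbT.
Qed.

Lemma over_refl f' : over (h f') f'.
Proof. by rewrite /over eqxx. Qed.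

Lemma over_label f f1 f2 : over f f1 -> over f f2 -> joinedF' f1 f2.
Proof.
move=> o1 o2; apply/joined_label/eqP; rewrite pf_h.
have B g : inB g = ((pf P g == pf P f0) || (pf P g == pf P g0)) by [].
case/orP: o1 => [/eqP e1|/andP[b1 b1']]; case/orP: o2 => [/eqP e2|/andP[b2 b2']].
- by rewrite -e1 e2 eqxx.
- by rewrite b2' B -e1 -B b2 orbT.
- by rewrite b1' B -e2 -B b1 orbT.
- by rewrite b1' b2' orbT.
Qed.

(** Forwards, merged blocks are joined through the edge [e]. Backwards, [h] has no inverse, so the
    relation is proved for all lifts along [over]; transitivity then needs a lift of the middle
    face. *)
Lemma joined_face u v : joinedF' u v = joinedF (h u) (h v).
Proof.
apply/idP/idP.
  apply: (joined_least (r := fun u v => joinedF (h u) (h v))).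
  - by move=> {}u; apply: joined_refl.
  - by move=> {}u {}v; rewrite joined_sym.
  - by move=> {}u {}v w; apply: joined_trans.
  - move=> {}u {}v /eqP; rewrite pf_h => /orP[/eqP|/andP[]]; first exact: joined_label.
    move=> /joined_inB uB /joined_inB vB; apply: joined_trans uB _.
    by rewrite joined_sym.
  - move=> x xA; apply: joined_trans (joined_h_rfx _) _.
    rewrite joined_sym; apply: joined_trans (joined_h_rfx _) _; rewrite joined_sym.
    by apply: (joined_edge _ _ false); rewrite in_setU1 imset_f ?orbT.
pose r f g := forall f' g', over f f' -> over g g' -> joinedF' f' g'.
move=> uv; suff: r (h u) (h v) by apply; apply: over_refl.
move: (h u) (h v) uv => {u v}; apply: (joined_least (r := r)).
- by move=> f f1 f2; apply: over_label.
- by move=> f g rfg g' f' og of'; rewrite joined_sym; apply: rfg.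
- move=> f1 f2 f3 r12 r23 f1' f3' o1 o3; have [f2' o2] := over_ex f2.
  exact: joined_trans (r12 _ _ o1 o2) (r23 _ _ o2 o3).
- move=> f g fg f' g' of' og; apply: over_label of' _.
  by move: og; rewrite /over /inB fg.
- move=> x; rewrite in_setU1 => /predU1P[->|/imsetP[y yA ->]] f' g' of' og.
    apply: (@over_label f0) of' _; move: og; rewrite /over -/g0.
    by move=> /orP[/eqP gE|/andP[_ ->]]; rewrite /inB ?gE !eqxx ?orbT.
  have oy b : over (rfx G (ie y, b)) (rfx G' (y, b)).
    rewrite /over h_rfx; case: ifP => [/meets_inB mB|_]; last by rewrite eqxx.
    by rewrite mB /inB eqxx orbT.
  apply: joined_trans (over_label of' (oy false)) _.
  apply: joined_trans (over_label (oy true) og).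
  exact: (joined_edge _ _ false).
Qed.

Lemma face_surj u : exists u', joinedF u (h u').
Proof.
have [f' o] := over_ex u; exists f'; case/orP: o => [/eqP|/andP[/joined_inB uB /joined_inB f'B]].
  exact: joined_label.
by apply: joined_trans uB _; rewrite joined_sym.
Qed.

(** If both sides of [e] lie in one block, [e] is a loop of the packaged graph and its removal
    lowers the nullity by one. Otherwise an edge and a block disappear together. *)
Lemma nullity_face : nullity (rfx G) (pf P) A = 2 - eta P e + nullity (rfx G') (pf P') A'.
Proof.
have := leq_nlabels_comps (rfx G') (pf P') A'.
rewrite /nullity (card_comps_transport joined_face face_surj) size_nlabels_merged.
rewrite (perm_size (perm_nlabels_meet (in_setT _) (in_setT _))) size_cat preimsetT.
rewrite cardsU1 (card_imset _ ie_inj).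
have -> : e \notin ie @: A' by apply/imsetP => -[x _ xE]; have := ie_neq x; rewrite -xE eqxx.
rewrite /eta -/f0 -/g0; move: #|comps _ _ _| (size _) #|A'| => k l a; case: ifP => _ /=; lia.
Qed.

(** A component away from [e] is unchanged. In the other one an edge is lost; this is balanced by
    the extra unit of weight if the blocks agree, and by the loss of a block, with weights added, if
    they differ. The boundary count is the same. *)
Lemma gidx_face (C : {set rface G}) : C \in comps (rfx G) (pf P) A ->
  gidx (rphi G') (rfx G') (pf P') (wf P') A' (h @^-1: C) =
  gidx (rphi G) (rfx G) (pf P) (wf P) A C.
Proof.
move=> Ccomp; have clos := comps_closed Ccomp; rewrite /gidx.
set S' := [set x in A' | _].
have ieS : [set x in ie @: A' | rfx G (x, false) \in C] = ie @: S'.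
  apply/setP => x; apply/idP/imsetP => [|[y]].
    rewrite inE => /andP[/imsetP[y yA ->] yC]; exists y => //.
    by rewrite !inE yA (clos _ _ (joined_h_rfx _)).
  by rewrite !inE (clos _ _ (joined_h_rfx _)) => /andP[yA yC] ->; rewrite imset_f.
have g0E : (g0 \in C) = (f0 \in C) by apply/clos/joined_e.
have [f0C|f0C] := boolP (f0 \in C); last first.
  have g0C : g0 \notin C by rewrite g0E.
  have CB : {in C, forall u, ~~ inB u}.
    by move=> u uC; apply: contra f0C => /joined_inB/clos <-.
  have -> : [set x in A | rfx G (x, false) \in C] = ie @: S'.
    rewrite -ieS; apply/setP => x; rewrite !inE.
    by case: eqP => [->|//]; rewrite -/f0 (negbTE f0C) !andbF.
  rewrite (card_imset _ ie_inj) nbound_face_avoid //; last first.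
    case=> x b; rewrite inE /= -ieS inE => /andP[xA]; case: b => //.
    by rewrite (clos _ _ (joined_edge _ _ false _)) // in_setU1 xA orbT.
  rewrite size_nlabels_merged (perm_size (perm_nlabels_avoid CB)) sum_nlabels_merged.
  rewrite (perm_big _ (perm_nlabels_avoid CB)) /=; congr (Posz (_ + _) - _)%R.
  apply: eq_big_seq => l /mem_nlabels[f']; rewrite inE /q /W => f'C ->.
  rewrite (negbTE (CB _ f'C)); case: ifP => // fE.
  by move: (CB _ f'C); rewrite /inB fE.
have g0C : g0 \in C by rewrite g0E.
have -> : [set x in A | rfx G (x, false) \in C] = e |: ie @: S'.
  rewrite -ieS; apply/setP => x; rewrite !inE.
  by case: eqP => [->|//]; rewrite -/f0 f0C.
rewrite -nbound_face_meet // cardsU1 (card_imset _ ie_inj).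
have -> : e \notin ie @: S' by apply/imsetP => -[x _ xE]; have := ie_neq x; rewrite -xE eqxx.
rewrite size_nlabels_merged sum_nlabels_merged (perm_size (perm_nlabels_meet f0C g0C)).
rewrite (perm_big _ (perm_nlabels_meet f0C g0C)) /= big_cat size_cat /=.
(* The label of [f0] is the only one at which [W] differs from [wf P], so its term is split off from
   the sum. *)
have f0q : pf P f0 \in nlabels q (h @^-1: C).
  have [f' f'E] := new_face; apply/mem_nlabels; exists f'; first by rewrite inE h_new.
  by rewrite /q h_new // /inB eqxx.
rewrite !(bigD1_seq _ f0q (nlabels_uniq _ _)) /=.
have -> : \sum_(l <- nlabels q (h @^-1: C) | l != pf P f0) W l =
    \sum_(l <- nlabels q (h @^-1: C) | l != pf P f0) wf P l.
  by apply: eq_bigr => l /negbTE lf; rewrite /W lf.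
rewrite /W eqxx; move: (\sum_(l <- _ | _) _) (nbound _ _ _ _) (size (nlabels q _)) #|S'|.
move=> s n z c; case: ifP => _; rewrite ?big_nil ?big_seq1 /=; lia.
Qed.

End Edges.

(** * Sum over the edge sets avoiding [e] *)

Lemma setC_imset_ie (A' : {set redge G'}) : ~: (ie @: A') = e |: ie @: (~: A').
Proof.
apply/setP => x; rewrite in_setC in_setU1; have [->|/=] := eqVneq x e.
  by apply/imsetP => -[y _ yE]; have := ie_neq y; rewrite -yE eqxx.
by rewrite -codom_ie => /codomP[y ->]; rewrite !mem_imset // in_setC.
Qed.

Local Open Scope ring_scope.

Lemma Tterm_deletion (R : comPzRingType) (x y : R) (xs ys : int -> R) (A' : {set redge G'}) :
  Tterm P x y xs ys (ie @: A') = x ^+ (2 - eta P e) * Tterm P' x y xs ys A'.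
Proof.
rewrite /Tterm setC_imset_ie nullity_face -nullity_vertex exprD -!mulrA.
congr (_ * (_ * (_ * (_ * _)))).
  apply/esym/(big_comps_transport (joined_face (~: A')) (face_surj (~: A'))) => C.
  by move=> /gidx_face ->.
apply/esym/(big_comps_transport (joined_vertex A') (vertex_surj A')) => C _.
by rewrite gidx_vertex.
Qed.

Lemma sum_Tterm_deletion (R : comPzRingType) (x y : R) (xs ys : int -> R) :
  \sum_(A : {set redge G} | e \notin A) Tterm P x y xs ys A =
  x ^+ (2 - eta P e) * Tpoly P' x y xs ys.
Proof.
rewrite TpolyE big_distrr /=.
under [RHS]eq_bigr => A' _ do rewrite -Tterm_deletion.
transitivity (\sum_(A' in [set: {set redge G'}]) Tterm P x y xs ys (ie @: A')); last first.
  by apply: eq_bigl => A'; rewrite inE.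
rewrite -(big_imset (h := fun A' : {set redge G'} => ie @: A') (A := setT)
  (Tterm P x y xs ys)); last by move=> A B _ _; apply: imset_inj.
apply: eq_bigl => A; apply/idP/imsetP => [eA|[A' _ ->]].
  exists (ie @^-1: A) => //; apply/setP => z; apply/idP/imsetP => [zA|[z']].
    have : z != e by apply: contraNneq eA => <-.
    by rewrite -codom_ie => /codomP[z' zE]; exists z'; rewrite // inE -zE.
  by rewrite inE => z'A ->.
by apply/imsetP => -[z _ zE]; have := ie_neq z; rewrite -zE eqxx.
Qed.
End Deletion.

Local Open Scope ring_scope.

Lemma deletion_recursion (P P' : pkg) (e : redge (pg P)) (R : comPzRingType)
    (x y : R) (xs ys : int -> R) : pkg_ok P -> pkg_ok P' -> is_deletion P e P' ->
  \sum_(A : {set redge (pg P)} | e \notin A) Tterm P x y xs ys A =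
  x ^+ (2 - eta P e) * Tpoly P' x y xs ys.
Proof.
move=> okP okP' [ie [iv [jf [H1 [H2 [H3 [H4 [H5 [H6 [H7 [H8 [H9 [H10 [H11 H12]]]]]]]]]]]]]].
apply: (@sum_Tterm_deletion P P' e okP okP' ie iv jf) => //.
have -> // : darts [set~ e] = [set d : redge (pg P) * bool | d.1 != e].
by apply/setP => d; rewrite !inE.
Qed.

(** * Duality and the recursion *)

Lemma rphi_rdual G : rphi (rdual G) = rsigma G.
Proof. by rewrite [RHS]rsigma_rphi. Qed.

Lemma pdual_ok P : pkg_ok P -> pkg_ok (pdual P).
Proof. by rewrite /pkg_ok => -[h1 h2 h3]; split=> //; rewrite rphi_rdual. Qed.

Lemma Tterm_pdual (R : comPzRingType) P (x y : R) (xs ys : int -> R) (A : {set redge (pg P)}) :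
  Tterm (pdual P) y x ys xs A = Tterm P x y xs ys (~: A).
Proof.
rewrite /Tterm /= rphi_rdual setCK [y ^+ _ * _]mulrC -!mulrA.
by congr (_ * (_ * _)); apply: mulrC.
Qed.

Lemma Tpoly_pdual (R : comPzRingType) P (x y : R) (xs ys : int -> R) :
  Tpoly (pdual P) y x ys xs = Tpoly P x y xs ys.
Proof.
rewrite !TpolyE; under eq_bigr => A _ do rewrite Tterm_pdual.
by rewrite [RHS](reindex_inj (can_inj (@setCK _))).
Qed.

Lemma contraction_recursion (P P' : pkg) (e : redge (pg P)) (R : comPzRingType)
    (x y : R) (xs ys : int -> R) : pkg_ok P -> pkg_ok P' -> is_contraction P e P' ->
  \sum_(A : {set redge (pg P)} | e \in A) Tterm P x y xs ys A =
  y ^+ (2 - mu P e) * Tpoly P' x y xs ys.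
Proof.
move=> /pdual_ok okP /pdual_ok okP' /(deletion_recursion y x ys xs okP okP').
rewrite Tpoly_pdual => <-; rewrite (reindex_inj (can_inj (@setCK _))).
by apply: eq_big => A; rewrite ?in_setC // Tterm_pdual.
Qed.

(** * Ribbon graphs without edges *)

(** Each component is a single block whose vertices are discs with one boundary each, so the index
    is 2 plus the weight, minus 1 for the block and minus its size. *)
Lemma prod_comps_noedge (R : comPzRingType) (E X : finType) (rho : {perm E * bool})
    (lab : E * bool -> X) (p : X -> nat) (w : nat -> nat) (xs : int -> R) : #|E| = 0%N ->
  \prod_(C in comps lab p set0) xs (gidx rho lab p w set0 C) =
  \prod_(l <- nlabels p setT) xs ((1 + w l)%N%:Z - #|[set u | p u == l]|%:Z).
Proof.
move=> E0; rewrite -big_enum (perm_big _ (perm_comps_set0 lab p)) /= big_map.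
apply: eq_big_seq => _ /mem_nlabels[u _ ->]; congr xs.
set C := [set v | p v == p u].
have lC : perm_eq (nlabels p C) [:: p u].
  apply: uniq_perm; rewrite ?nlabels_uniq // => l; rewrite inE.
  apply/mem_nlabels/eqP => [[v]|->]; first by rewrite inE => /eqP -> ->.
  by exists u; rewrite // inE.
have D0 (S : {set E}) : darts S = set0.
  by apply/setP => -[z]; have := fintype0 z E0.
rewrite /gidx (perm_size lC) (perm_big _ lC) big_seq1 nboundE.
have -> : [set z in set0 | lab (z, false) \in C] = set0.
  by apply/setP => z; rewrite !inE.
rewrite D0 imset0 !cards0; have -> : untouched lab set0 = setT.
  by apply/setP => v; rewrite !inE; apply/forall_inP => d; rewrite inE.
rewrite setIT /=; move: #|C| => c; lia.
Qed.

Lemma Tpoly_noedge (R : comPzRingType) (P : pkg) (x y : R) (xs ys : int -> R) :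
  #|redge (pg P)| = 0%N ->
  Tpoly P x y xs ys =
    \prod_(l <- nlabels (pf P) setT)
       xs ((1 + wf P l)%N%:Z - #|[set f | pf P f == l]|%:Z)
    * \prod_(l <- nlabels (pv P) setT)
       ys ((1 + wv P l)%N%:Z - #|[set v | pv P v == l]|%:Z).
Proof.
move=> E0; have A0 (A : {set redge (pg P)}) : A = set0.
  by apply/setP => z; have := fintype0 z E0.
rewrite TpolyE (big_pred1 set0) => [|A]; last exact/esym/eqP.
rewrite /Tterm (A0 (~: set0)) !prod_comps_noedge //.
by rewrite /nullity !card_comps_set0 cards0 !subnn !mul1r.
Qed.

Theorem theorem3p3 :
  (forall (R : comPzRingType) (P Pd Pc : pkg) (e : redge (pg P))
          (x y : R) (xs ys : int -> R),
     pkg_ok P -> pkg_ok Pd -> pkg_ok Pc ->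
     is_deletion P e Pd -> is_contraction P e Pc ->
     Tpoly P x y xs ys =
       x ^+ (2 - eta P e) * Tpoly Pd x y xs ys
       + y ^+ (2 - mu P e) * Tpoly Pc x y xs ys)
  /\
  (forall (R : comPzRingType) (P : pkg) (x y : R) (xs ys : int -> R),
     pkg_ok P -> #|redge (pg P)| = 0%N ->
     Tpoly P x y xs ys =
       \prod_(l <- nlabels (pf P) setT)
          xs ((1 + wf P l)%N%:Z - #|[set f | pf P f == l]|%:Z)
       * \prod_(l <- nlabels (pv P) setT)
          ys ((1 + wv P l)%N%:Z - #|[set v | pv P v == l]|%:Z)).
Proof.
split=> [R P Pd Pc e x y xs ys okP okPd okPc del con|R P x y xs ys _].
  rewrite -(deletion_recursion x y xs ys okP okPd del).
  rewrite -(contraction_recursion x y xs ys okP okPc con).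
  by rewrite TpolyE (bigID (fun A : {set redge (pg P)} => e \in A)) addrC.
exact: Tpoly_noedge.
Qed.
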